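(* For all integers $n \geqslant 2$ and $m \geqslant 1$ with $(m,n)=1$, $$\left| S_2(n,m) - \tfrac{1}{4} n^2 \varphi(n) \right| \leqslant n^{2} \, \sigma_{1/2}(n) \, \bigl(\tau(n) \log (en)\bigr)^2 + \tfrac{1}{4} n \varphi(n).$$
   Context: $(a,b)$ denotes the greatest common divisor, $\varphi$ is Euler's totient function, $\log$ is the natural logarithm and $e = \exp(1)$. For real $\lambda$, $\sigma_\lambda(n) := \sum_{d \mid n} d^\lambda$ (sum over positive divisors), and $\tau(n) := \sigma_0(n)$ is the number of positive divisors of $n$. For integers $n \geqslant 2$, $m \geqslant 1$ with $(m,n)=1$, $$S_2(n,m) := \sum_{\substack{1 \leqslant a,b \leqslant n \\ ab \equiv m \ (\mathrm{mod}\ n)}} ab ,$$ with the convention that only pairs with $(a,n)=(b,n)=1$ contribute (this is automatic because $(m,n)=1$). *)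

(* Defs.v *)
From mathcomp Require Import all_boot all_order all_algebra.
From mathcomp Require Import all_classical all_reals all_analysis.

Set Implicit Arguments.
Unset Strict Implicit.
Unset Printing Implicit Defensive.

Import Order.TTheory GRing.Theory Num.Theory.

Local Open Scope ring_scope.

Definition sigma (R : realType) (lambda : R) (n : nat) : R :=
  \sum_(d <- divisors n) (d%:R `^ lambda).

Definition tau (R : realType) (n : nat) : R := sigma (0 : R) n.

(* The two coprimality conditions are redundant when m is coprime to n:
   see S2E. *)
Definition S2 (n m : nat) : nat :=
  (\sum_(1 <= a < n.+1) \sum_(1 <= b < n.+1 |
     [&& coprime a n, coprime b n & a * b == m %[mod n]]) a * b)%N.

Lemma S2E (n m : nat) : coprime m n ->
  S2 n m =
  (\sum_(1 <= a < n.+1) \sum_(1 <= b < n.+1 | a * b == m %[mod n]) a * b)%N.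
Proof.
move=> mn; apply: eq_bigr => a _; apply: eq_bigl => b.
have [/eqP abm|] := boolP (a * b == m %[mod n])%N; last by rewrite !andbF.
have : coprime (a * b) n by rewrite -coprime_modl abm coprime_modl.
by rewrite coprimeMl => /andP[-> ->].
Qed.

Lemma tauE (R : realType) (n : nat) : tau R n = (size (divisors n))%:R.
Proof.
rewrite /tau /sigma (eq_bigr (fun=> 1)) => [|d _]; last by rewrite powRr0.
by rewrite big_const_seq count_predT iter_addr_0.
Qed.

(* Main.v *)
Require Import Defs.
From HB Require Import structures.
From mathcomp Require Import all_boot all_order all_algebra all_field.
From mathcomp Require Import all_classical all_reals all_analysis.
From mathcomp Require Import complex.
From mathcomp Require Import zify ring lra.

(** Write saw a = a/n - 1/2, an odd function under a |-> n - a.  In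
    a b = n^2 (1/2 + saw a) (1/2 + saw b), summed over the modular hyperbola
    a b = m (mod n), the constant term gives n^2 phi(n) / 4 and the two linear
    terms vanish by oddness; the error is n^2 times the sum of saw a * saw b
    over the hyperbola ([S2_saw]).

    The finite Fourier coefficient of saw at the frequency h vanishes for h = 0
    and is a cotangent, at most (1/h + 1/(n-h)) / 2 in absolute value, for
    0 < h < n ([sawhat0], [norm_sawhat]).  The error is therefore a weighted
    sum, over nonzero frequencies h and k, of the Kloosterman sums Kl(h, k)
    modulo n ([saw_sum_Kl]), for which
        |Kl(h, k)|^2 <= tau(n)^2 gcd(h, k, n) n          ([Kl_bound]).
    The square root of the gcd is at most the sum of d^(1/2) over the common
    divisors d of h, k and n, and the weights at the multiples of d sum to at
    most (1 + ln n) / d ([weight_sum]).  Each divisor d of n thus contributes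
    d^(1/2) (1 + ln n)^2 / d^2 <= (1 + ln n)^2, and the total is
    n^(1/2) tau(n)^2 (1 + ln n)^2, where n^(1/2) is one of the terms of
    sigma_(1/2)(n).

    Kloosterman sums are multiplicative in the modulus ([Kl_crt]), and a common
    prime factor of h and k can be taken out of them ([Kl_reduce]).  This leaves
    prime powers p^e where p does not divide both h and k.  If e >= 2, averaging
    over the substitutions x |-> x (1 + p^j t) with j = floor(e/2) turns the sum
    into quadratic Gauss sums supported at the few stationary points of the
    phase ([average_bound], [Kl_prime_power_unit]).

    If e = 1 and p is odd and divides neither h nor k, this is Weil's bound
    |K| <= 2 p^(1/2) ([weil_bound]); the other cases with e = 1 are easy
    ([Kl_prime]).  Weil's bound is proved by elementary means.  The Kloosterman
    character extends to a completely multiplicative function on the monic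
    polynomials over F_p, whose generating series is the polynomial
    1 + K T + p T^2 = (1 - alpha T) (1 - beta T).  Its logarithmic derivative
    shows that the Kloosterman sum over the field with p^n elements is
    - (alpha^n + beta^n) ([kl_coef_newton]).  For n = 2k this is - p^k u_k,
    where u_k is the Lucas sequence of parameter theta = (K^2 - 2p) / p
    ([kloosterman_Fq_lucas]), and Weil's bound says that theta <= 2.  Now K is
    real, so theta >= -2 and u_k >= -2 always, while u_k grows without bound if
    theta > 2.  It is thus enough to bound from above, uniformly in k, the sum
    of u_k over the nontrivial characters ([lucas_sum_le]); by orthogonality this
    asks for a lower bound for the number of x in the field with q = p^(2k)
    elements such that x + m/x has trace zero ([count_trace0]).  Such x come
    from the y for which (y^p - y)^2 - 4m is a square, and Stepanov's method
    shows that at most q/2 + O(q^(1/2)) of the y give a nonsquare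
    ([stepanov]). *)

Set Implicit Arguments.
Unset Strict Implicit.
Unset Printing Implicit Defensive.

Import Order.TTheory GRing.Theory Num.Theory.
Import numFieldNormedType.Exports.

Local Open Scope ring_scope.

(** * Stepanov's auxiliary polynomial *)

Lemma poly_lin_dep (F : fieldType) (I : finType) (B : nat) (e : I -> {poly F}) :
  (forall i, (size (e i) <= B)%N) -> (B < #|I|)%N ->
  exists2 z : I -> F, (exists i, z i != 0) & \sum_i z i *: e i = 0.
Proof.
move=> sze ltBI.
pose A : 'M[F]_(#|I|, B) := \matrix_i poly_rV (e (enum_val i)).
have : kermx A != 0.
  rewrite kermx_eq0 /row_free; apply/negP => /eqP rA.
  by have := rank_leq_col A; rewrite rA leqNgt ltBI.
case/rowV0Pn => v /sub_kermxP vA v0.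
exists (fun i => v 0 (enum_rank i)).
  move/rV0Pn: v0 => [j vj]; exists (enum_val j); by rewrite enum_valK.
have : rVpoly (v *m A) = 0 by rewrite vA linear0.
rewrite mulmx_sum_row linear_sum /= => vA0; apply: etrans vA0.
rewrite [RHS](reindex enum_rank) /=; last exact/onW_bij/enum_rank_bij.
by apply: eq_bigr => i _; rewrite linearZ /= rowK enum_rankK poly_rV_K.
Qed.

Lemma coef_sumX (R : nzRingType) (m : nat) (F : 'I_m -> R) (i : 'I_m) :
  (\sum_(j < m) F j *: 'X^j)`_i = F i.
Proof.
rewrite coef_sum (bigD1 i) //= coefZ coefXn eqxx mulr1 big1 ?addr0 // => j ji.
rewrite coefZ coefXn; case: eqP => [E|]; last by rewrite mulr0.
by rewrite (val_inj (esym E)) eqxx in ji.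
Qed.

Lemma lt_pair_index (l i j a M : nat) : (i < a)%N -> (j < M)%N ->
  (i * l + j < (a - 1) * l + M)%N.
Proof.
move=> ia jM; rewrite -addnS leq_add // leq_mul2r; apply/orP; right.
by rewrite subn1 -ltnS (ltn_predK ia).
Qed.

Lemma le_pair_index (l i j d e M : nat) : (i < d)%N -> (j < M)%N ->
  (i * l + j + (e * l.+1).+1 <= (d + e - 1) * l + M + e)%N.
Proof.
move=> id jM; have := lt_pair_index l id jM.
have -> : ((d + e - 1) = (d - 1) + e)%N by lia.
by rewrite mulnDl mulnS; lia.
Qed.

(** The vanishing of the auxiliary polynomial at the given points is a system
    of linear equations with more unknowns, on the right, than equations. *)
Lemma count_unknowns (l e a M : nat) : (e ^ 2 + 2 * e < l)%N ->
  (2 * a = l.+1)%N -> (2 * M = l + e)%N ->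
  ((a - 1) * l + M + e < M * (l.+1 - e))%N.
Proof.
rewrite -mulnn => el Ea EM; rewrite -(ltn_pmul2l (isT : 0 < 2)%N) !mulnDr !mulnA EM.
have [r rE] : exists r, l = (e * e + 2 * e + r.+1)%N.
  by exists (l - (e * e + 2 * e)).-1%N; lia.
have -> : (l.+1 - e = e * e + e + r.+2)%N by lia.
have -> : (2 * (a - 1) = e * e + 2 * e + r)%N by lia.
by rewrite {el Ea EM}rE; lia.
Qed.

(** The degree of the auxiliary polynomial bounds the number of its roots. *)
Lemma count_roots (l e a M s : nat) : (2 * a = l.+1)%N -> (2 * M = l + e)%N ->
  (s < a + (M + e - 1) * l)%N -> (2 * s <= l ^ 2 + 3 * e * l)%N.
Proof.
case: l => [|l] Ea EM; first by rewrite muln0; lia.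
rewrite -(ltn_pmul2l (isT : 0 < 2)%N) mulnDr Ea mulnA mulnBr.
by rewrite mulnDr EM -mulnn; lia.
Qed.

(** At a point y of the field with l^2 elements, this splits the power l of
    f(y)^((l+1)/2) into f(y)^((l+1)/2) and the quadratic character of f(y). *)
Lemma half_exponent (l : nat) : odd l ->
  (l.+1./2 * l = ((l ^ 2).-1)./2 + l.+1./2)%N.
Proof.
move=> odd_l; rewrite -(odd_double_half l) odd_l add1n; move: (l./2) => b.
have -> : ((b.*2.+1 ^ 2).-1 = (2 * b * b + 2 * b).*2)%N by rewrite -mulnn; lia.
rewrite doubleK (_ : b.*2.+2 = b.+1.*2) // doubleK; lia.
Qed.

(** Stepanov's method with a single condition at each point. Let l = p^k and
    g = f^((l+1)/2), and let S consist of points y of the field with l^2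
    elements at which f(y) is a nonsquare. The auxiliary polynomial is the
    sum over j of (A_j + D_j g) X^(j l), where the A_j and D_j have degree
    below about l/2. Since y^(l^2) = y and g(y)^l = - g(y) at the points of
    S, its l-th power takes there the values of a polynomial of degree about
    l^2/2, whose coefficients are linear in the l-th powers of the unknown
    coefficients. A nonzero choice of the unknowns makes that polynomial
    identically zero. *)
Section Stepanov.
Variables (K : closedFieldType) (p : nat).
Hypotheses (charK : p \in [pchar K]) (odd_p : odd p).
Variables (k e : nat) (f : {poly K}).
Let l := (p ^ k)%N.
Hypotheses (odd_e : odd e) (le : (e ^ 2 + 2 * e < l)%N).
Hypotheses (szf : size f = (2 * e).+1) (f0 : f`_0 != 0).
Hypothesis fsimple : exists x, mup x f = 1%N.
Let g := f ^+ (l.+1)./2.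

Let odd_l : odd l.
Proof. by rewrite /l oddX odd_p orbT. Qed.

Let lnat : [pchar K].-nat l.
Proof.
by rewrite /l pnatX (eq_pnat _ (pcharf_eq charK)) pnat_id ?(pcharf_prime charK).
Qed.

Let lnatP : [pchar {poly K}].-nat l.
Proof.
rewrite -(@eq_pnat [pchar K]) // => q; by rewrite -pchar_poly.
Qed.

Let exprDl (x y : K) : (x + y) ^+ l = x ^+ l + y ^+ l.
Proof. exact: exprDn_pchar. Qed.

Let fn0 : f != 0.
Proof. by rewrite -size_poly_gt0 szf. Qed.

Lemma frob_mod (q : {poly K}) : 'X^l %| q ^+ l - (q`_0 ^+ l)%:P.
Proof.
have -> : q ^+ l = (drop_poly 1 q ^+ l) * 'X^l + (q`_0 ^+ l)%:P.
  rewrite -{1}(poly_take_drop 1 q) addrC exprDn_pchar // exprMn -exprM mul1n.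
  congr (_ + _); rewrite polyC_exp; congr (_ ^+ _).
  by apply/polyP => i; rewrite coef_take_poly coefC; case: i.
by rewrite addrK dvdp_mulIr.
Qed.

(** Modulo X^l the polynomial g^2 = f f^l is f(0)^l f, so if X^l divides A +
    D g then it divides A^2 - f(0)^l D^2 f. By degrees the latter is zero,
    and at a simple root of f the two squares and f have incompatible
    parities of multiplicity. *)
Lemma no_cancel (A D : {poly K}) :
  (2 * size A <= l.+1)%N -> (2 * (size D + e) <= l.+1)%N ->
  'X^l %| A + D * g -> A = 0 /\ D = 0.
Proof.
move=> sA sD dv.
have : 'X^l %| A ^+ 2 - D ^+ 2 * f * (f`_0 ^+ l)%:P.
  have -> : A ^+ 2 - D ^+ 2 * f * (f`_0 ^+ l)%:P = (A + D * g) * (A - D * g)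
     + D ^+ 2 * f * (f ^+ l - (f`_0 ^+ l)%:P).
    have gg : g ^+ 2 = f * f ^+ l.
      rewrite -exprM muln2 -exprS; congr (_ ^+ _).
      by rewrite -[RHS]odd_double_half /= odd_l.
    rewrite [(A + _) * _]mulrC -subr_sqr [(D * g) ^+ 2]exprMn gg; ring.
  by apply: dvdp_add; [apply: dvdp_mulr|apply: dvdp_mull; apply: frob_mod].
move/dvdp_leq => szle.
have : A ^+ 2 - D ^+ 2 * f * (f`_0 ^+ l)%:P = 0.
  apply/eqP; apply: contraT => /szle; rewrite size_polyXn ltnNge; case/negP.
  apply: leq_trans (size_polyD _ _) _; rewrite geq_max size_polyN.
  apply/andP; split.
    apply: leq_trans (size_poly_exp_leq _ _) _.
    move: sA (leq_ltn_trans (leq0n _) le); move: (l) (size A) => L s; clear; lia.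
  rewrite mulrC mul_polyC.
  apply: leq_trans (size_scale_leq _ _) _.
  have [->|D0] := eqVneq D 0; first by rewrite expr0n mul0r size_poly0.
  rewrite size_mul ?expf_neq0 // szf.
  have := size_poly_exp_leq D 2; have := size_poly_gt0 D; rewrite D0.
  by move: sD; move: (l) (size D) (size (D ^+ 2)) => L s t; clear; lia.
move/eqP; rewrite subr_eq0 => /eqP AD.
have [D0|D0] := eqVneq D 0.
  move: AD; rewrite D0 expr0n !mul0r => /eqP.
  by rewrite expf_eq0 /= => /eqP ->.
have c0 : f`_0 ^+ l != 0 by rewrite expf_eq0 negb_and f0 orbT.
have A0 : A != 0.
  have : D ^+ 2 * f * (f`_0 ^+ l)%:P != 0.
    by rewrite !mulf_neq0 ?expf_neq0 ?polyC_eq0.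
  by rewrite -AD; apply: contraNneq => ->; rewrite expr0n.
have [x mx] := fsimple.
have := congr1 (fun q => odd (mup x q)) AD.
rewrite /= !mupM ?mulf_neq0 ?expf_neq0 ?polyC_eq0 // mx !oddD !addbb /=.
by rewrite mupNroot // rootC.
Qed.

(** The auxiliary polynomial is nonzero unless all its coefficients are: the
    lowest block is zero by [no_cancel], and X^l can then be divided out. *)
Lemma no_cancel_sum (M : nat) (A D : nat -> {poly K}) :
  (forall j, (j < M)%N -> (2 * size (A j) <= l.+1)%N) ->
  (forall j, (j < M)%N -> (2 * (size (D j) + e) <= l.+1)%N) ->
  \sum_(j < M) (A j + D j * g) * 'X^(j * l) = 0 ->
  forall j, (j < M)%N -> A j = 0 /\ D j = 0.
Proof.
elim: M A D => // M IH A D sA sD.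
rewrite big_ord_recl mul0n mulr1 /= => H.
pose T := \sum_(j < M) (A j.+1 + D j.+1 * g) * 'X^(j * l).
have E : \sum_(i < M) (A (bump 0 i) + D (bump 0 i) * g) * 'X^(bump 0 i * l)
   = T * 'X^l.
  rewrite mulr_suml; apply: eq_bigr => i _.
  by rewrite -mulrA -exprD addnC.
rewrite E in H.
have [A0 D0] : A 0%N = 0 /\ D 0%N = 0.
  apply: no_cancel; [exact: sA|exact: sD|].
  by move/eqP: H; rewrite addr_eq0 => /eqP ->; rewrite dvdpNr dvdp_mulIr.
move: H; rewrite A0 D0 mul0r !add0r => /eqP.
rewrite mulf_eq0 expf_eq0 polyX_eq0 andbF orbF => /eqP T0.
by case=> [|j] jM //; apply: (IH (fun j => A j.+1) (fun j => D j.+1)) => // i iM;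
  [apply: sA|apply: sD].
Qed.

Lemma stepanov (S : seq K) : uniq S ->
  (forall y, y \in S -> y ^+ (l ^ 2) = y) ->
  (forall y, y \in S -> f.[y] ^+ ((l ^ 2).-1)./2 = -1) ->
  (2 * size S <= l ^ 2 + 3 * e * l)%N.
Proof.
move=> uS Sq Sf.
have l0 : (0 < l)%N by case: (l) odd_l.
pose a := (l.+1)./2; pose d := (a - e)%N; pose M := (l + e)./2.
have Ea : (2 * a = l.+1)%N.
  by rewrite mul2n -[RHS]odd_double_half /= odd_l.
have EM : (2 * M = l + e)%N.
  by rewrite mul2n -[RHS]odd_double_half oddD odd_l odd_e.
have half_bound : (e <= a)%N.
  rewrite -(leq_pmul2l (isT : 0 < 2)%N) Ea leqW // ltnW //.
  by apply: leq_ltn_trans le; apply: leq_addl.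
have Ed : (a = d + e)%N by rewrite /d subnK // half_bound.
have M_gt0 : (0 < M)%N by rewrite -(ltn_pmul2l (isT : 0 < 2)%N) EM addn_gt0 l0.
pose I : finType := ('I_M * 'I_a + 'I_M * 'I_d)%type.
pose B := ((a - 1) * l + M + e)%N.
have szg : size g = (e * l.+1).+1.
  have := size_exp f (l.+1)./2; rewrite szf /= -/g => sg.
  rewrite polySpred ?expf_neq0 // sg; congr _.+1.
  by rewrite -/a mulnAC Ea mulnC.
have gn0 : g != 0 by rewrite expf_neq0.
pose u (i : I) : {poly K} := match i with
  | inl (j, i) => 'X^(i * l + j)
  | inr (j, i) => - ('X^(i * l + j) * g) end.
have [i||z [i0 zi0] z0] := @poly_lin_dep K I B u.
- case: i => -[j i] /=.
    by rewrite size_polyXn /B ltn_addr ?lt_pair_index.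
  by rewrite size_polyN mulrC size_mulXn // szg /B Ed le_pair_index.
- rewrite card_sum !card_prod !card_ord /B -mulnDr.
  have -> : (a + d = l.+1 - e)%N by rewrite /d addnBA ?addnn -?mul2n ?Ea // Ed leq_addl.
  exact: count_unknowns le Ea EM.
(* The linear system determines the l-th powers of the coefficients; K is
   closed under l-th roots. *)
have rt (x : K) : exists y, y ^+ l == x.
  have /closed_rootP [y] : size ('X^l - x%:P : {poly K}) != 1%N.
    by rewrite size_XnsubC // eqSS -lt0n.
  by rewrite /root !hornerE subr_eq0; exists y.
pose r x := xchoose (rt x).
have rE x : r x ^+ l = x by apply/eqP/(xchooseP (rt x)).
pose c i := r (z i).
have cE i : c i ^+ l = z i by exact: rE.
have c_i0 : c i0 != 0.
  by apply: contraNneq zi0 => ci0; rewrite -cE ci0 expr0n; case: (l) l0.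
pose w (i : I) : {poly K} := match i with
  | inl (j, i) => 'X^(i + j * l)
  | inr (j, i) => 'X^(i + j * l) * g end.
pose H := \sum_i c i *: w i.
have szH : (size H <= a + (M + e - 1) * l)%N.
  apply: leq_trans (size_sum _ _ _) _; apply/bigmax_leqP => i _.
  apply: leq_trans (size_scale_leq _ _) _.
  case: i => -[j i] /=.
    rewrite size_polyXn addnC; apply: leq_trans (lt_pair_index l _ (ltn_ord i)) _.
      exact: ltn_ord j.
    by rewrite addnC leq_add2l leq_mul2r -addnBAC ?leq_addr ?orbT // M_gt0.
  rewrite mulrC size_mulXn // szg [(i + _)%N]addnC.
  apply: leq_trans (le_pair_index l e (ltn_ord j) (ltn_ord i)) _.
  by rewrite -addnA -Ed addnC.
(* At the points of S, the l-th power of [H] takes the value of the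
   combination that vanishes by [z0]. *)
have Hy y : y \in S -> root H y.
  move=> yS; rewrite /root.
  suff : H.[y] ^+ l == 0 by rewrite expf_eq0 => /andP[].
  have sumX (J : finType) (F : J -> K) : (\sum_i F i) ^+ l = \sum_i (F i) ^+ l.
    by apply: (big_morph (fun x => x ^+ l) exprDl); rewrite expr0n -[l]prednK.
  have yl j : y ^+ (j * l * l) = y ^+ j.
    by rewrite -mulnA mulnn mulnC exprM Sq.
  have := congr1 (horner^~ y) z0; rewrite /= horner_sum horner0 => <-.
  rewrite /H horner_sum sumX; apply/eqP/eq_bigr => i _.
  rewrite !hornerZ exprMn cE; congr (_ * _).
  case: i => -[j i] /=; rewrite ?hornerN ?hornerM ?hornerXn.
    by rewrite -exprM mulnDl exprD yl -exprD.
  rewrite exprMn -exprM mulnDl exprD yl -exprD -mulrN; congr (_ * _).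
  rewrite /g horner_exp -exprM.
  have -> : (l.+1./2 * l = ((l ^ 2).-1)./2 + l.+1./2)%N by exact: half_exponent.
  by rewrite exprD Sf // mulN1r.
(* Regrouped by j, [H] has the form treated in [no_cancel_sum]. *)
have Hn0 : H != 0.
  apply/eqP => H0.
  pose A (j : nat) : {poly K} := \sum_(i < a) (if insub j is Some j' then
       c (inl (j', i)) else 0) *: 'X^i.
  pose D (j : nat) : {poly K} := \sum_(i < d) (if insub j is Some j' then
       c (inr (j', i)) else 0) *: 'X^i.
  have szX (m : nat) (F : 'I_m -> K) : (size (\sum_(i < m) F i *: 'X^i)%R <= m)%N.
    apply: leq_trans (size_sum _ _ _) _; apply/bigmax_leqP => i _.
    by apply: leq_trans (size_scale_leq _ _) _; rewrite size_polyXn.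
  have AD : forall j, (j < M)%N -> A j = 0 /\ D j = 0.
  apply: no_cancel_sum.
  - by move=> j _; rewrite -Ea leq_pmul2l // szX.
  - by move=> j _; rewrite -Ea leq_pmul2l // [X in (_ <= X)%N]Ed leq_add2r szX.
  - apply: etrans H0; rewrite /H big_sumType /=.
    have pairE (m : nat) (F : 'I_M * 'I_m -> {poly K}) :
       \sum_i F i = \sum_j \sum_i F (j, i).
      by rewrite pair_bigA /=; apply: eq_bigr => -[].
    rewrite !pairE -big_split; apply: eq_bigr => j _ /=.
    rewrite mulrDl /A /D valK !mulr_suml; congr (_ + _).
      by apply: eq_bigr => i _; rewrite -scalerAl -exprD.
    apply: eq_bigr => i _; rewrite -!scalerAl exprD -!mulrA; congr (_ *: (_ * _)).
    by rewrite mulrC.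
  case: i0 c_i0 {zi0} => -[j i] /eqP; case.
    have [Aj _] := AD j (ltn_ord j); have := congr1 (fun q : {poly K} => q`_(val i)) Aj.
    by rewrite /A coef_sumX coef0 valK.
  have [_ Dj] := AD j (ltn_ord j); have := congr1 (fun q : {poly K} => q`_(val i)) Dj.
  by rewrite /D coef_sumX coef0 valK.
have /(max_poly_roots Hn0) : all (root H) S by apply/allP.
move=> /(_ uS) szS.
exact: count_roots Ea EM (leq_trans szS szH).
Qed.
End Stepanov.

(** * Frobenius orbits and polynomials over the prime field *)

Lemma sum_multiples_le d u n : (0 < d)%N -> (d * u <= n)%N ->
  (\sum_(j < n) ((d %| j.+1) && (j.+1 %/ d <= u)) = u)%N.
Proof.
move=> d0; elim: n u => [|n IH] u duN; first by rewrite big_ord0; nia.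
rewrite big_ord_recr /=; have [duE|duE] := eqVneq (d * u)%N n.+1.
  case: u duN duE => [|u] duN duE; first by rewrite muln0 in duE.
  rewrite -duE dvdn_mulr // mulKn // leqnn addn1; congr _.+1.
  rewrite -[RHS]IH; last by rewrite mulnS in duE; lia.
  apply: eq_bigr => j _; case: dvdnP => //= -[k jE].
  rewrite jE mulnK //; congr nat_of_bool.
  have : (k * d < u.+1 * d)%N by rewrite -jE [(u.+1 * d)%N]mulnC duE ltnS.
  by rewrite ltn_pmul2r // ltnS => ku; rewrite ku leqW.
have duN' : (d * u <= n)%N by rewrite -ltnS ltn_neqAle duE.
rewrite IH //; case: dvdnP => [[k kE]|_]; last by rewrite addn0.
rewrite kE mulnK // leqNgt -(ltn_pmul2r d0) -kE mulnC ltnS duN' addn0 //.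
Qed.

Section Frobenius.
Variables (K : closedFieldType) (p : nat) (charK : p \in [pchar K]).
Let p_pr : prime p := pcharf_prime charK.

Definition frob i (x : K) := x ^+ (p ^ i).

Lemma frob_is_nmod i : nmod_morphism (frob i).
Proof.
split=> [|x y]; rewrite /frob.
  by rewrite expr0n expn_eq0 eqn0Ngt prime_gt0.
by rewrite exprDn_pchar // pnatX (eq_pnat _ (pcharf_eq charK)) pnat_id.
Qed.
Lemma frob_is_monoid i : monoid_morphism (frob i).
Proof. by split=> [|x y]; rewrite /frob ?expr1n // exprMn. Qed.
HB.instance Definition _ i := GRing.isNmodMorphism.Build K K (frob i) (frob_is_nmod i).
HB.instance Definition _ i := GRing.isMonoidMorphism.Build K K (frob i) (frob_is_monoid i).

Lemma frob_add i x y : frob i (x + y) = frob i x + frob i y.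
Proof. exact: (rmorphD (frob i)). Qed.
Lemma frob_sub i x y : frob i (x - y) = frob i x - frob i y.
Proof. exact: (rmorphB (frob i)). Qed.
Lemma frob_nat i c : frob i c%:R = c%:R.
Proof. exact: (rmorph_nat (frob i)). Qed.

Lemma frob_comp i j x : frob (i + j) x = frob i (frob j x).
Proof. by rewrite /frob -exprM -expnD addnC. Qed.
Lemma frob0 x : frob 0 x = x.
Proof. by []. Qed.
Lemma frob_inj i : injective (frob i).
Proof. exact: fmorph_inj. Qed.

(** The subfields of all degrees occur together, hence as lists of elements
    of one algebraically closed field. *)
Definition Fq n : seq K := sval (closed_field_poly_normal ('X^(p ^ n) - 'X)).

Section FqTheory.
Variables (n : nat) (n0 : (0 < n)%N).
Let q1 : (1 < p ^ n)%N.
Proof. by rewrite -(expn0 p) ltn_exp2l ?prime_gt1. Qed.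
Let szX : size ('X^(p ^ n) - 'X : {poly K}) = (p ^ n).+1.
Proof. by rewrite size_polyDl ?size_polyXn // size_polyN size_polyX. Qed.

Lemma Fq_prod : 'X^(p ^ n) - 'X = \prod_(x <- Fq n) ('X - x%:P).
Proof.
rewrite /Fq; case: closed_field_poly_normal => s /= sE.
rewrite {1}sE; suff -> : lead_coef ('X^(p ^ n) - 'X : {poly K}) = 1 by rewrite scale1r.
by rewrite lead_coefDl ?lead_coefXn // size_polyN size_polyX size_polyXn.
Qed.

Lemma size_Fq : size (Fq n) = (p ^ n)%N.
Proof.
by apply/eqP; rewrite -eqSS -(size_prod_XsubC (Fq n) id) -Fq_prod szX.
Qed.

Lemma mem_Fq x : (x \in Fq n) = (frob n x == x).
Proof.
by rewrite -root_prod_XsubC -Fq_prod /root !hornerE subr_eq0.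
Qed.

Lemma uniq_Fq : uniq (Fq n).
Proof.
rewrite -separable_prod_XsubC -Fq_prod unlock derivB derivXn derivX.
suff -> : ('X^((p ^ n).-1) *+ (p ^ n) : {poly K}) = 0.
  rewrite sub0r (_ : - 1 = (- 1) *: 1); last by rewrite scaleN1r.
  by rewrite coprimepZr ?oppr_eq0 ?oner_eq0 ?coprimep1.
rewrite -mulr_natr -(prednK n0) expnS natrM -polyC_natr.
by rewrite (pcharf0 charK) polyC0 mul0r mulr0.
Qed.
End FqTheory.

(** If [frob j x = x], this is the characteristic polynomial of x in the
    extension of degree j of the prime field. *)
Definition orbit_prod x j : {poly K} := \prod_(i < j) ('X - (frob i x)%:P).

Lemma orbit_prod_monic x j : orbit_prod x j \is monic.
Proof. by apply: monic_prod => i _; rewrite monicXsubC. Qed.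

Lemma size_orbit_prod x j : size (orbit_prod x j) = j.+1.
Proof. by rewrite size_prod_XsubC -[index_enum _]enumT size_enum_ord. Qed.

Lemma orbit_prod_frob x j : frob j x = x -> map_poly (frob 1) (orbit_prod x j) = orbit_prod x j.
Proof.
case: j => [|j] fx; first by rewrite /orbit_prod !big_ord0 rmorph1.
rewrite /orbit_prod rmorph_prod /= big_ord_recr big_ord_recl mulrC /=.
rewrite map_polyXsubC /= -frob_comp add1n fx frob0; congr (_ * _).
by apply: eq_bigr => i _; rewrite map_polyXsubC /= -frob_comp.
Qed.

Variable emb : {rmorphism 'F_p -> K}.

Lemma frob1_emb a : frob 1 (emb a) = emb a.
Proof.
rewrite /frob expn1 -rmorphXn; congr (emb _).
by have := expf_card a; rewrite card_Fp.
Qed.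

Lemma frob_emb i a : frob i (emb a) = emb a.
Proof. by elim: i => [|i IH] //; rewrite -addn1 frob_comp frob1_emb. Qed.

Lemma frob1_fixed x : frob 1 x = x -> exists a, emb a = x.
Proof.
move=> fx; have := congr1 (map_poly emb) (finField_genPoly 'F_p).
rewrite card_Fp // rmorphB /= map_polyXn map_polyX rmorph_prod /=.
move/(congr1 (fun q => root q x)); rewrite /= {1}/root !hornerE subr_eq0.
rewrite -[X in x ^+ X]expn1 -/(frob 1 x) fx eqxx => /esym.
rewrite /root horner_prod prodf_seq_eq0 => /hasP[a _] /=.
by rewrite map_polyXsubC !hornerE subr_eq0 => /eqP ->; exists a.
Qed.

Lemma frob_fixed_poly (h : {poly K}) : map_poly (frob 1) h = h ->
  exists h0, map_poly emb h0 = h.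
Proof.
move=> fh.
have ex i : exists a, emb a == h`_i.
  have [|a <-] := @frob1_fixed h`_i; last by exists a.
  by rewrite -[in RHS]fh coef_map.
exists (\poly_(i < size h) (xchoose (ex i))).
apply/polyP => i; rewrite coef_map coef_poly.
case: ltnP => [_|szi]; first by apply/eqP; exact: (xchooseP (ex i)).
by rewrite nth_default ?raddf0.
Qed.

Lemma orbit_poly_ex x j :
  exists h, if frob j x == x then map_poly emb h == orbit_prod x j else true.
Proof.
case: eqP => [fx|_]; last by exists 0.
by have [h <-] := frob_fixed_poly (orbit_prod_frob fx); exists h.
Qed.
(** The same polynomial with coefficients in the prime field; its value is
    arbitrary if [frob j x] is not [x]. *)
Definition orbit_poly x j := xchoose (orbit_poly_ex x j).

Lemma map_orbit_poly x j : frob j x = x -> map_poly emb (orbit_poly x j) = orbit_prod x j.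
Proof.
by move=> fx; move: (xchooseP (orbit_poly_ex x j)); rewrite -/(orbit_poly x j) {1}fx eqxx => /eqP.
Qed.

Lemma orbit_poly_monic x j : frob j x = x -> orbit_poly x j \is monic.
Proof. by move=> fx; rewrite -(map_monic emb) map_orbit_poly ?orbit_prod_monic. Qed.

Lemma size_orbit_poly x j : frob j x = x -> size (orbit_poly x j) = j.+1.
Proof. by move=> fx; rewrite -(size_map_poly emb) map_orbit_poly ?size_orbit_prod. Qed.

Lemma mup_frob (f : {poly 'F_p}) x i : f != 0 ->
  mup (frob i x) (map_poly emb f) = mup x (map_poly emb f).
Proof.
move=> f0; have F0 : map_poly emb f != 0 by rewrite map_poly_eq0.
have fF : map_poly (frob i) (map_poly emb f) = map_poly emb f.
  by apply/polyP => k; rewrite !coef_map /= frob_emb.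
apply/eqP; rewrite eqn_leq; apply/andP; split.
  rewrite mup_geq // -(dvdp_map (frob i)) fF rmorphXn /= map_polyXsubC.
  by rewrite -mup_geq.
rewrite mup_geq // -[X in _ %| X]fF -(map_polyXsubC (frob i)) -rmorphXn dvdp_map.
by rewrite -mup_geq.
Qed.

(** Here d is the degree of x over the prime field, so that [orbit_prod x d]
    is the minimal polynomial of x; the longer orbit products of x that are
    stable under Frobenius are its powers. *)
Section Orbit.
Variables (x : K) (d : nat).
Hypotheses (d0 : (0 < d)%N) (fd : frob d x = x).
Hypothesis dmin : forall i, (0 < i < d)%N -> frob i x != x.

Lemma frob_mulr k : frob (k * d) x = x.
Proof. by elim: k => [|k IH] //; rewrite mulSn frob_comp IH. Qed.

Lemma frob_modr i : frob i x = frob (i %% d) x.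
Proof. by rewrite {1}(divn_eq i d) addnC frob_comp frob_mulr. Qed.

Lemma frob_fix_dvd i : (frob i x == x) = (d %| i)%N.
Proof.
apply/eqP/idP => [|/dvdnP[k ->]]; last exact: frob_mulr.
rewrite frob_modr => fi; apply: contraT; rewrite /dvdn -lt0n => im.
by have := @dmin (i %% d); rewrite im ltn_pmod // fi eqxx => /(_ isT).
Qed.

Lemma orbit_prod_dvd k (f : {poly 'F_p}) : f != 0 ->
  (orbit_prod x d ^+ k %| map_poly emb f) = (k <= mup x (map_poly emb f))%N.
Proof.
move=> f0; have F0 : map_poly emb f != 0 by rewrite map_poly_eq0.
apply/idP/idP => [dv|kle].
  rewrite mup_geq //; apply: dvdp_trans dv; rewrite dvdp_exp2r //.
  by rewrite /orbit_prod (bigD1 (Ordinal d0)) //= frob0 dvdp_mulIl.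
suff H i : (i <= d)%N -> orbit_prod x i ^+ k %| map_poly emb f by apply: H.
rewrite /orbit_prod; elim: i => [|i IH] id; first by rewrite big_ord0 expr1n dvd1p.
rewrite big_ord_recr /= exprMn Gauss_dvdp.
  apply/andP; split; first exact: IH (ltnW id).
  by rewrite -mup_geq ?mup_frob.
rewrite coprimep_expl // coprimep_expr // coprimep_XsubC /root horner_prod.
apply/prodf_neq0 => j _; rewrite !hornerE subr_eq0.
have -> : frob i x = frob j (frob (i - j) x) by rewrite -frob_comp subnKC // ltnW.
rewrite (inj_eq (@frob_inj j)) dmin // subn_gt0 ltn_ord.
by rewrite (leq_ltn_trans (leq_subr _ _)).
Qed.

Lemma orbit_prod_mul k : orbit_prod x (d * k) = orbit_prod x d ^+ k.
Proof.
elim: k => [|k IH]; first by rewrite muln0 /orbit_prod big_ord0.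
rewrite mulnS /orbit_prod big_split_ord exprS -IH; congr (_ * _).
by apply: eq_bigr => i _ /=; rewrite addnC frob_comp fd.
Qed.

(** The orbit polynomials of x exist for the multiples j = d k of the degree
    of x, and the one for d k is the k-th power of the minimal polynomial. It
    divides f exactly if k is at most the multiplicity of x in f. *)
Lemma count_orbit_poly_dvd (f : {poly 'F_p}) n : f \is monic -> size f = n.+1 ->
  (\sum_(j < n) ((frob j.+1 x == x) && (orbit_poly x j.+1 %| f)%R) =
   mup x (map_poly emb f))%N.
Proof.
move=> fmon szf; have f0 : f != 0 := monic_neq0 fmon.
rewrite -[RHS](@sum_multiples_le d _ n) //.
  apply: eq_bigr => j _; rewrite frob_fix_dvd.
  case: dvdnP => //= -[k jE]; rewrite jE mulnK //; congr nat_of_bool.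
  rewrite -(orbit_prod_dvd k f0) -(dvdp_map emb) (map_orbit_poly (frob_mulr k)).
  by rewrite mulnC orbit_prod_mul.
have : orbit_prod x d ^+ mup x (map_poly emb f) %| map_poly emb f.
  by rewrite orbit_prod_dvd.
move/dvdp_leq; rewrite map_poly_eq0 size_map_poly szf => /(_ f0).
by rewrite -orbit_prod_mul size_orbit_prod ltnS.
Qed.
End Orbit.

(** The images of a root under the powers of Frobenius are again roots, so
    two of them coincide. *)
Lemma root_frob_period (f : {poly 'F_p}) x : f != 0 ->
  root (map_poly emb f) x -> exists2 d, (0 < d)%N & frob d x = x.
Proof.
move=> f0 rx.
have rF i : root (map_poly emb f) (frob i x).
  have fF : map_poly (frob i) (map_poly emb f) = map_poly emb f.
    by apply/polyP => k; rewrite !coef_map /= frob_emb.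
  by rewrite -fF rmorph_root.
pose s := [seq frob i x | i <- iota 0 (size f)].
have ns : ~~ uniq s.
  apply/negP => us; have := @max_poly_roots _ (map_poly emb f) s.
  rewrite map_poly_eq0 f0 size_map_poly size_map size_iota ltnn us => H.
  by suff: false by []; apply: H => //; apply/allP => y /mapP[i _ ->].
have [i [j [ij E]]] : exists i j, (i < j)%N /\ frob i x = frob j x.
  move: ns => /(uniqPn x)[i [j [ij js E]]]; exists i, j; split=> //.
  move: js E; rewrite size_map size_iota => js.
  by rewrite !(nth_map 0%N) ?size_iota ?nth_iota ?(ltn_trans ij).
exists (j - i)%N; first by rewrite subn_gt0.
by apply: (@frob_inj i); rewrite -frob_comp subnKC // ltnW.
Qed.

(** Each root of f is counted as many times as its multiplicity
    ([count_orbit_poly_dvd]), and the multiplicities add up to the degree.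
    Summed over f with multiplicative weights, this is the logarithmic
    derivative of an Euler product, obtained without the factorization of f
    into irreducibles. *)
Lemma sum_orbit_poly_dvd (f : {poly 'F_p}) n : f \is monic -> size f = n.+1 ->
  (\sum_(j < n) \sum_(x <- Fq j.+1) (orbit_poly x j.+1 %| f)%R = n)%N.
Proof.
move=> fmon szf; have f0 : f != 0 := monic_neq0 fmon.
have [r rE] := closed_field_poly_normal (map_poly emb f).
have fm : map_poly emb f \is monic by rewrite map_monic.
move: rE; rewrite (monicP fm) scale1r => rE.
have szr : size r = n.
  by apply/eqP; rewrite -eqSS -(size_prod_XsubC r id) -rE size_map_poly szf.
have memr x : (x \in r) = root (map_poly emb f) x by rewrite rE root_prod_XsubC.
have step (j : 'I_n) : (\sum_(x <- Fq j.+1) (orbit_poly x j.+1 %| f)%R =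
    \sum_(x <- undup r) ((frob j.+1 x == x) && (orbit_poly x j.+1 %| f)%R))%N.
  have cb (b : bool) : (b = (if b then 1 else 0) :> nat)%N by case: b.
  under eq_bigr do rewrite cb; rewrite -big_mkcond /=.
  under [RHS]eq_bigr do rewrite cb; rewrite -[RHS]big_mkcond /=.
  rewrite -big_filter -[RHS]big_filter; apply: perm_big.
  apply: uniq_perm; rewrite ?filter_uniq ?uniq_Fq ?undup_uniq // => x.
  rewrite !mem_filter mem_Fq // mem_undup memr.
  case: eqP => [fx|]; rewrite ?andbF //=.
  rewrite andbT; case: (boolP (_ %| _)) => //= dv; apply/esym.
  rewrite -dvdp_XsubCl; apply: dvdp_trans (_ : map_poly emb (orbit_poly x j.+1) %| _).
    by rewrite map_orbit_poly // /orbit_prod big_ord_recl frob0 dvdp_mulIl.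
  by rewrite dvdp_map.
rewrite (eq_bigr _ (fun j _ => step j)) exchange_big /=.
rewrite -[RHS]szr -[size r]sum1_size -[RHS]big_undup_iterop_count /=.
rewrite big_seq [RHS]big_seq; apply: eq_bigr => x; rewrite mem_undup memr => rx.
have [d' d'0 fd'] := root_frob_period f0 rx.
have ex : exists d, (0 < d)%N && (frob d x == x) by exists d'; rewrite d'0 fd' eqxx.
have [d /andP[d0 /eqP fd] dm] := ex_minnP ex.
rewrite (@count_orbit_poly_dvd x d) // => [|i /andP[i0 ilt]].
  rewrite rE mu_prod_XsubC; case: (count_mem x r) => // c; rewrite iteropS.
  by elim: c => // c IH; rewrite iterS -IH.
by apply: contraTneq ilt => fi; rewrite -leqNgt dm // i0 fi eqxx.
Qed.
End Frobenius.

(** * The L-function of the Kloosterman character *)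

Section SubleadingCoef.
Variable F : fieldType.
Implicit Types f g : {poly F}.

(** The second coefficient from the top, that is minus the sum of the roots
    if f is monic. The factor X gives the value 0, and not the leading
    coefficient, to the constant polynomials. *)
Definition coef_top f : F := ('X * f)`_(size f).-1.
(** Minus the sum of the inverses of the roots. *)
Definition coef_bot f : F := f`_1 / f`_0.

(** The sum of the roots is additive; the proof compares coefficients, since
    the roots need not lie in F. *)
Lemma coef_topM f g : f \is monic -> g \is monic ->
  coef_top (f * g) = coef_top f + coef_top g.
Proof.
have mE (h : {poly F}) : h \is monic -> h = 'X^((size h).-1) + take_poly (size h).-1 h.
  move=> hm; rewrite -{1}(poly_take_drop (size h).-1 h) addrC.
  have -> : drop_poly (size h).-1 h = 1.
    apply/polyP => i; rewrite coef_drop_poly coef1; case: i => [|i].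
      by move/monicP: hm; rewrite lead_coefE add0n.
    by rewrite nth_default // addSn; case: (size h) => // m /=; rewrite ltnS leq_addl.
  by rewrite mul1r.
move=> fm gm; rewrite /coef_top size_Mmonic ?monic_neq0 //.
have := mE f fm; have := mE g gm.
have [a aE] : exists a, size f = a.+1.
  by exists (size f).-1; rewrite prednK // size_poly_gt0 monic_neq0.
have [b bE] : exists b, size g = b.+1.
  by exists (size g).-1; rewrite prednK // size_poly_gt0 monic_neq0.
rewrite aE bE /= addnS /=.
have := size_take_poly a f; have := size_take_poly b g.
move: (take_poly a f) (take_poly b g) => A B sB sA -> ->.
rewrite !coefXM addn_eq0.
case: a sA {aE} => [|a] sA; case: b sB {bE} => [|b] sB.
- by rewrite add0n !eqxx addr0.
- move: sA; rewrite size_poly_leq0 => /eqP ->; rewrite expr0 addr0 mul1r /=.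
  by rewrite ?add0n ?add0r.
- move: sB; rewrite size_poly_leq0 => /eqP ->; rewrite expr0 addr0 mulr1 /=.
  by rewrite ?addn0 ?addr0.
rewrite /= mulrDl !mulrDr !coefD -exprD !coefXn coefXnM coefMXn.
rewrite (_ : (a + b.+1 == a.+1 + b.+1)%N = false); last by lia.
rewrite (_ : (a == a.+1) = false); last by lia.
rewrite (_ : (b == b.+1) = false); last by lia.
rewrite (_ : (a + b.+1 < a.+1)%N = false); last by lia.
rewrite (_ : (a + b.+1 < b.+1)%N = false); last by lia.
rewrite (_ : (a + b.+1 - a.+1 = b)%N); last by lia.
rewrite (_ : (a + b.+1 - b.+1 = a)%N); last by lia.
rewrite [(A * B)`_ _]nth_default ?addr0 ?add0r 1?addrC //.
by apply: leq_trans (size_polyMleq _ _) _; lia.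
Qed.

Lemma coef_botM f g : f`_0 != 0 -> g`_0 != 0 ->
  coef_bot (f * g) = coef_bot f + coef_bot g.
Proof.
move=> f0 g0; rewrite /coef_bot coef0M coefM !big_ord_recr big_ord0 /= add0r.
by rewrite /bump /= subn0; field; rewrite f0 g0.
Qed.

Lemma coef_top_XsubC x : coef_top ('X - x%:P) = - x.
Proof. by rewrite /coef_top size_XsubC coefXM /= coefB coefX coefC sub0r. Qed.

Lemma coef_bot_XsubC x : coef_bot ('X - x%:P) = - x^-1.
Proof. by rewrite /coef_bot !coefB !coefX !coefC /= sub0r subr0 invrN mul1r. Qed.

Lemma coef_top1 : coef_top 1 = 0.
Proof. by rewrite /coef_top size_poly1 coefXM. Qed.

Lemma coef_bot1 : coef_bot 1 = 0.
Proof. by rewrite /coef_bot coef1 mul0r. Qed.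
End SubleadingCoef.

Section Lfun.
Variables (p : nat) (p_pr : prime p) (m : 'F_p).
Variables (C : numClosedFieldType) (psi : 'F_p -> C).
Hypotheses (psi0 : psi 0 = 1) (psiD : forall a b, psi (a + b) = psi a * psi b).

(** The sum of x + m/x over the roots x of f. *)
Definition ptrace (f : {poly 'F_p}) : 'F_p := - (coef_top f + m * coef_bot f).
Definition kl_weight (f : {poly 'F_p}) : C := if f`_0 == 0 then 0 else psi (ptrace f).

Lemma kl_weightM (f g : {poly 'F_p}) : f \is monic -> g \is monic ->
  kl_weight (f * g) = kl_weight f * kl_weight g.
Proof.
move=> fm gm; rewrite /kl_weight coef0M mulf_eq0.
have [f0|f0] := eqVneq f`_0 0; first by rewrite mul0r.
have [g0|g0] := eqVneq g`_0 0; first by rewrite mulr0.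
rewrite -psiD; congr psi; rewrite /ptrace coef_topM // coef_botM //; ring.
Qed.

(** The monic polynomials of degree n, indexed by a finite type. *)
Definition row_poly n (v : 'rV['F_p]_n) : {poly 'F_p} := 'X^n + rVpoly v.

Lemma size_row_poly n v : size (@row_poly n v) = n.+1.
Proof. by rewrite /row_poly size_polyDl size_polyXn // ltnS size_poly. Qed.

Lemma row_poly_monic n v : @row_poly n v \is monic.
Proof.
by rewrite /row_poly monicE lead_coefDl ?lead_coefXn // size_polyXn ltnS size_poly.
Qed.

Lemma row_poly_inj n : injective (@row_poly n).
Proof. by move=> u v /addrI /(can_inj rVpolyK). Qed.

Lemma row_poly_surj n (f : {poly 'F_p}) : f \is monic -> size f = n.+1 ->
  row_poly (poly_rV f : 'rV_n) = f.
Proof.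
move=> /monicP; rewrite lead_coefE => + szf; rewrite szf /= => fn.
apply/polyP => i; rewrite coefD coefXn coef_rVpoly.
case: insubP => [j jn <-|]; first by rewrite mxE ltn_eqF //= add0r.
rewrite -leqNgt leq_eqVlt => /orP[/eqP <-|ni]; first by rewrite eqxx addr0 fn.
by rewrite gtn_eqF //= addr0 nth_default // szf.
Qed.

Lemma poly_rV_row_poly n (v : 'rV_n) : poly_rV (row_poly v) = v.
Proof. by apply: row_poly_inj; rewrite row_poly_surj ?row_poly_monic ?size_row_poly. Qed.

(** The coefficient of T^n in the L-function of [kl_weight]. *)
Definition kl_coef n : C := \sum_v kl_weight (@row_poly n v).

Lemma sum_kl_weight_dvd (g : {poly 'F_p}) j n : g \is monic -> size g = j.+1 -> (j <= n)%N ->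
  \sum_(v : 'rV_n | g %| row_poly v) kl_weight (row_poly v) = kl_weight g * kl_coef (n - j).
Proof.
move=> gm szg jn; rewrite /kl_coef mulr_sumr.
have g0 := monic_neq0 gm.
have szM (w : 'rV_(n - j)) : size (g * row_poly w) = n.+1.
  by rewrite size_Mmonic ?row_poly_monic // szg size_row_poly addnS /= addSn subnKC.
have mM (w : 'rV_(n - j)) : g * row_poly w \is monic by rewrite monicMl ?row_poly_monic.
rewrite (reindex_onto (fun w : 'rV_(n - j) => poly_rV (g * row_poly w) : 'rV_n)
          (fun v => poly_rV (row_poly v %/ g))).
  apply: eq_big => [w|w _]; rewrite row_poly_surj // ?kl_weightM ?row_poly_monic //.
  by rewrite dvdp_mulIl [g * _]mulrC mulpK // poly_rV_row_poly eqxx.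
move=> v gv; apply: row_poly_inj; rewrite row_poly_surj ?row_poly_monic ?size_row_poly //.
have hE : row_poly v %/ g * g = row_poly v by rewrite divpK.
have hm : row_poly v %/ g \is monic by rewrite -(monicMr _ gm) hE row_poly_monic.
have szh : size (row_poly v %/ g) = (n - j).+1.
  have := congr1 (fun h : {poly 'F_p} => size h) hE.
  rewrite /= size_row_poly size_Mmonic ?monic_neq0 // szg addnS /= => E.
  by rewrite -subSn // -E addnK.
by rewrite (row_poly_surj hm szh) mulrC hE.
Qed.

Variables (K : closedFieldType) (charK : p \in [pchar K]) (emb : {rmorphism 'F_p -> K}).

Local Notation orbit_poly := (orbit_poly charK emb).

(** By [emb_ptrace] this is the Kloosterman sum over the field with p^j
    elements, for the character psi composed with the trace. *)
Definition kloosterman_Fq j : C := \sum_(x <- Fq K p j) kl_weight (orbit_poly x j).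

(** This is T L' = L * (sum over j of the Kloosterman sums times T^j),
    coefficient by coefficient. Write n as a count of orbit polynomials
    dividing f by [sum_orbit_poly_dvd], then sum over the multiples of each
    of them. *)
Lemma kl_coef_newton n : n%:R * kl_coef n = \sum_(j < n) kloosterman_Fq j.+1 * kl_coef (n - j.+1).
Proof.
rewrite /kl_coef mulr_sumr.
transitivity (\sum_(v : 'rV_n) \sum_(j < n) \sum_(x <- Fq K p j.+1)
   (if orbit_poly x j.+1 %| row_poly v then kl_weight (row_poly v) else 0)).
  apply: eq_bigr => v _.
  rewrite -{1}(sum_orbit_poly_dvd charK emb (row_poly_monic v) (size_row_poly v)).
  rewrite natr_sum mulr_suml.
  apply: eq_bigr => j _; rewrite natr_sum mulr_suml; apply: eq_bigr => x _.
  by case: ifP; rewrite ?mul1r ?mul0r.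
rewrite exchange_big; apply: eq_bigr => j _ /=; rewrite exchange_big mulr_suml /=.
rewrite big_seq [RHS]big_seq; apply: eq_bigr => x.
rewrite (mem_Fq charK) // => /eqP fx.
by rewrite -big_mkcond (@sum_kl_weight_dvd _ j.+1) ?orbit_poly_monic ?size_orbit_poly.
Qed.
End Lfun.

(** * The L-function is quadratic *)

(** Translation by a multiplies the sum by psi a. *)
Lemma sum_char (V : finZmodType) (C : fieldType) (psi : V -> C) a :
  (forall a b, psi (a + b) = psi a * psi b) -> psi a != 1 -> \sum_x psi x = 0.
Proof.
move=> psiD a1; have : (psi a - 1) * \sum_x psi x = 0.
  rewrite mulrBl mul1r mulr_sumr [X in _ - X](reindex_inj (addrI a)) /=.
  by apply/eqP; rewrite subr_eq0; apply/eqP/eq_bigr => x _; rewrite psiD.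
by move/eqP; rewrite mulf_eq0 subr_eq0 (negPf a1) => /eqP.
Qed.

Section Lvalues.
Variables (p : nat) (p_pr : prime p) (m : 'F_p) (m0 : m != 0).
Variables (C : numClosedFieldType) (psi : 'F_p -> C).
Hypotheses (psi0 : psi 0 = 1) (psiD : forall a b, psi (a + b) = psi a * psi b).

Local Notation kl_weight := (kl_weight m psi).
Local Notation kl_coef := (kl_coef m psi).

Lemma kl_coef0 : kl_coef 0 = 1.
Proof.
rewrite /kl_coef (big_pred1 0) => [|v]; last by rewrite [v]thinmx0 /= eqxx.
rewrite /row_poly linear0 addr0 expr0 /kl_weight coef1 oner_eq0 /ptrace coef_top1 coef_bot1.
by rewrite mulr0 addr0 oppr0.
Qed.

Lemma coef_row_poly n (v : 'rV['F_p]_n) (i : 'I_n) : (row_poly v)`_i = v 0 i.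
Proof. by rewrite coefD coefXn ltn_eqF //= add0r coef_rVpoly_ord. Qed.

Definition kloosterman_Fp : C := \sum_(a | a != 0) psi (a + m / a).

Lemma kl_coef1 : kl_coef 1 = kloosterman_Fp.
Proof.
rewrite /kl_coef (reindex (fun a : 'F_p => \row_(i < 1) - a)) /=; last first.
  exists (fun v => - v 0 0) => [a|v] _; first by rewrite mxE opprK.
  by apply/rowP => i; rewrite mxE opprK ord1.
rewrite /kloosterman_Fp [RHS]big_mkcond; apply: eq_bigr => a _.
set v := \row__ _; have c0 : (row_poly v)`_0 = - a.
  by rewrite (coef_row_poly v 0) mxE.
have c1 : (row_poly v)`_1 = 1.
  by rewrite coefD coefXn /= [X in _ + X]nth_default ?addr0 // size_poly.
rewrite /kl_weight c0 oppr_eq0; case: eqP => //= a0.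
congr psi; rewrite /ptrace /coef_top /coef_bot size_row_poly coefXM /= c0 c1.
by rewrite opprD opprK div1r invrN mulrN opprK.
Qed.

Lemma kl_weight_row_poly n (v : 'rV['F_p]_n.+2) : kl_weight (row_poly v) =
  if v 0 0 == 0 then 0 else psi (- (v 0 ord_max + m * (v 0 1 / v 0 0))).
Proof.
rewrite /kl_weight (coef_row_poly v 0); case: eqP => // _.
rewrite /ptrace /coef_top /coef_bot size_row_poly coefXM /= (coef_row_poly v 0).
by rewrite (coef_row_poly v 1) (coef_row_poly v ord_max).
Qed.

Hypothesis psi1 : psi 1 != 1.

Lemma psi_nontriv c : c != 0 -> exists a, psi (a * c) != 1.
Proof. by move=> c0; exists c^-1; rewrite mulVf. Qed.

Lemma sum_psiM c : \sum_a psi (a * c) = if c == 0 then p%:R else 0.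
Proof.
case: eqP => [->|/eqP c0].
  under eq_bigr do rewrite mulr0 psi0.
  by rewrite sumr_const card_Fp.
have [a pa] := psi_nontriv c0.
by apply: (sum_char _ pa) => x y; rewrite mulrDl psiD.
Qed.

(** For f = X^2 + b X + a the weight is a nontrivial character of b, except
    for a = - m where it is 1 for all b. *)
Lemma kl_coef2 : kl_coef 2 = p%:R.
Proof.
rewrite /kl_coef (reindex (fun ab : 'F_p * 'F_p =>
   \row_(i < 2) if i == 0 then ab.1 else ab.2)) /=; last first.
  exists (fun v : 'rV_2 => (v 0 0, v 0 1)) => [[a b]|v] _; first by rewrite !mxE.
  apply/rowP => i; rewrite mxE; case: eqP => [->|] //=.
  case: i => -[|[|i]] i2 // i0; first by case: i0; apply: val_inj.
  by congr (v 0 _); apply: val_inj.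
under eq_bigr do rewrite kl_weight_row_poly !mxE /=.
rewrite -(pair_bigA _ (fun a b => if a == 0 then 0 else psi (- (b + m * (b / a))))) /=.
rewrite (bigD1 (- m)) //= [X in _ + X]big1 ?addr0 => [|a am].
  under eq_bigr => b _.
    rewrite oppr_eq0 (negPf m0) (_ : - (b + m * (b / - m)) = 0) ?psi0; last first.
      by rewrite invrN !mulrN mulrCA divff // mulr1 subrr oppr0.
    over.
  by rewrite sumr_const card_Fp.
have [//|a0] := eqVneq a 0; first by rewrite big1.
transitivity (\sum_b psi (b * (- (1 + m / a)))).
  by apply: eq_bigr => b _; congr psi; field.
rewrite sum_psiM oppr_eq0; case: eqP => // /(congr1 (fun x => x * a)).
rewrite mulrDl divfK // mul1r mul0r => /eqP; rewrite addr_eq0 => /eqP aE.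
by rewrite aE eqxx in am.
Qed.

(** From degree 3 on, the second coefficient from the top is not one of the
    two lowest coefficients: increasing it by 1 multiplies the weight by psi
    (-1). *)
Lemma kl_coef_ge3 n : kl_coef n.+3 = 0.
Proof.
have : (psi (-1) - 1) * kl_coef n.+3 = 0.
  rewrite mulrBl mul1r /kl_coef [X in _ - X](reindex_inj (addrI (delta_mx 0 ord_max))).
  apply/eqP; rewrite subr_eq0 mulr_sumr; apply/eqP/eq_bigr => v _.
  rewrite !kl_weight_row_poly !mxE !eqxx /=. rewrite !add0r.
  case: eqP => _; first by rewrite mulr0.
  by rewrite -psiD; congr psi; ring.
move/eqP; rewrite mulf_eq0 subr_eq0 => /orP[/eqP pN|/eqP //].
have := psiD 1 (-1); rewrite subrr psi0 pN mulr1 => E.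
by move: psi1; rewrite -E eqxx.
Qed.

Variables (K : closedFieldType) (charK : p \in [pchar K]) (emb : {rmorphism 'F_p -> K}).
Local Notation kloosterman_Fq := (kloosterman_Fq m psi charK emb).
Local Notation orbit_poly := (orbit_poly charK emb).

Lemma kloosterman_Fq1 : kloosterman_Fq 1 = kloosterman_Fp.
Proof.
have := kl_coef_newton m psiD charK emb 1; rewrite big_ord_recl big_ord0 addr0 subnn.
by rewrite kl_coef0 mulr1 mul1r kl_coef1.
Qed.

Lemma kloosterman_Fq2 : kloosterman_Fq 2 = 2 * p%:R - kloosterman_Fp ^+ 2.
Proof.
have := kl_coef_newton m psiD charK emb 2; rewrite !big_ord_recl big_ord0 addr0 /=.
rewrite subnn kl_coef0 kl_coef1 kl_coef2 kloosterman_Fq1 mulr1 => ->; ring.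
Qed.

(** Newton's identities for the power sums of two numbers with sum - K and
    product p, as the L-function is 1 + K T + p T^2. *)
Lemma kloosterman_Fq_rec n : kloosterman_Fq n.+3 =
  - kloosterman_Fp * kloosterman_Fq n.+2 - p%:R * kloosterman_Fq n.+1.
Proof.
have := kl_coef_newton m psiD charK emb n.+3.
rewrite kl_coef_ge3 mulr0 !big_ord_recr /= big1 => [|j _]; last first.
  have -> : (n.+3 - j.+1 = (n - j.+1).+3)%N.
    by move: (ltn_ord j); move: (nat_of_ord j) => {}j; clear; lia.
  by rewrite kl_coef_ge3 mulr0.
rewrite subnn subSnn (_ : n.+3 - n.+1 = 2)%N; last by clear; lia.
rewrite kl_coef0 kl_coef1 kl_coef2.
move: kloosterman_Fp (kloosterman_Fq _) (kloosterman_Fq _) (kloosterman_Fq _).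
by move=> k L1 L2 L3 E; rewrite -[LHS]subr0 E; ring.
Qed.
End Lvalues.

Section Trace.
Variables (p : nat) (p_pr : prime p) (m : 'F_p).
Variables (K : closedFieldType) (charK : p \in [pchar K]) (emb : {rmorphism 'F_p -> K}).
Local Notation orbit_poly := (orbit_poly charK emb).

Lemma coef0_orbit_prod_neq0 (x : K) n : x != 0 -> (orbit_prod p x n)`_0 != 0.
Proof.
move=> x0; rewrite /orbit_prod -horner_coef0 horner_prod; apply/prodf_neq0 => i _.
by rewrite !hornerE oppr_eq0 /frob expf_neq0.
Qed.

Lemma orbit_prodS (x : K) n : orbit_prod p x n.+1 = orbit_prod p x n * ('X - (frob p n x)%:P).
Proof. by rewrite /orbit_prod big_ord_recr. Qed.

Lemma coef_top_orbit_prod (x : K) n : coef_top (orbit_prod p x n) = - \sum_(i < n) frob p i x.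
Proof.
elim: n => [|n IH]; first by rewrite /orbit_prod !big_ord0 coef_top1 oppr0.
rewrite orbit_prodS big_ord_recr /= coef_topM ?monicXsubC ?orbit_prod_monic //.
by rewrite IH coef_top_XsubC opprD.
Qed.

Lemma coef_bot_orbit_prod (x : K) n : x != 0 ->
  coef_bot (orbit_prod p x n) = - \sum_(i < n) (frob p i x)^-1.
Proof.
move=> x0; elim: n => [|n IH]; first by rewrite /orbit_prod !big_ord0 coef_bot1 oppr0.
rewrite orbit_prodS big_ord_recr /= coef_botM ?coef0_orbit_prod_neq0 //.
  by rewrite IH coef_bot_XsubC opprD.
by rewrite coefB coefX coefC sub0r oppr_eq0 /frob expf_neq0.
Qed.

Lemma coef0_orbit_poly_eq0 (x : K) n : (0 < n)%N -> frob p n x = x ->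
  ((orbit_poly x n)`_0 == 0) = (x == 0).
Proof.
move=> n0 fx; rewrite -(fmorph_eq0 emb) -coef_map map_orbit_poly //.
have [->|x0] := eqVneq x 0; last by rewrite (negPf (coef0_orbit_prod_neq0 n x0)).
rewrite -horner_coef0 /orbit_prod (bigD1 (Ordinal n0)) //= hornerM !hornerE.
by rewrite /frob expr1 oppr0 mul0r eqxx.
Qed.

(** The argument of the character is the trace of x + m/x. *)
Lemma emb_ptrace (x : K) n : frob p n x = x -> x != 0 ->
  emb (ptrace m (orbit_poly x n)) = \sum_(i < n) frob p i (x + emb m / x).
Proof.
move=> fx x0; rewrite /ptrace rmorphN rmorphD rmorphM /=.
have -> : emb (coef_top (orbit_poly x n)) = coef_top (orbit_prod p x n).
  rewrite -(map_orbit_poly charK emb fx) /coef_top size_map_poly -coef_map rmorphM /=.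
  by rewrite map_polyX.
have -> : emb (coef_bot (orbit_poly x n)) = coef_bot (orbit_prod p x n).
  by rewrite -(map_orbit_poly charK emb fx) /coef_bot rmorphM fmorphV !coef_map.
rewrite coef_top_orbit_prod coef_bot_orbit_prod // mulrN -opprD opprK mulr_sumr -big_split /=.
apply: eq_bigr => i _; rewrite /frob exprDn_pchar.
  by rewrite exprMn exprVn -[X in X / _](frob_emb charK emb i).
by rewrite pnatX (eq_pnat _ (pcharf_eq charK)) pnat_id.
Qed.
End Trace.

(** * Counting elements of trace zero *)

Lemma count_sum (T : Type) (a : pred T) (s : seq T) : count a s = (\sum_(x <- s) a x)%N.
Proof. by elim: s => [|x s IH]; rewrite ?big_nil // big_cons /= IH. Qed.

Section Count.
Variables (p : nat) (p_pr : prime p) (odd_p : odd p) (m : 'F_p) (m0 : m != 0).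
Variables (K : closedFieldType) (charK : p \in [pchar K]) (emb : {rmorphism 'F_p -> K}).
Local Notation orbit_poly := (orbit_poly charK emb).
Local Notation M := (emb m).

Let two0 : 2%:R != 0 :> K.
Proof.
rewrite -(dvdn_pcharf charK) dvdn_prime2 //.
by apply: contraTneq odd_p => ->.
Qed.

Let four0 : 4%:R != 0 :> K.
Proof. by rewrite (natrM _ 2 2) mulf_neq0. Qed.

Let M0 : M != 0.
Proof. by rewrite fmorph_eq0. Qed.

(** The discriminant of x^2 - (y^p - y) x + m, whose roots are the x with x +
    m/x = y^p - y. *)
Definition disc_poly : {poly K} := ('X^p - 'X) ^+ 2 - (2%:R ^+ 2 * M)%:P.
Local Notation f := disc_poly.

Let p1 : (1 < p)%N := prime_gt1 p_pr.

Let szXp (c : {poly K}) : (size c <= p)%N -> size ('X^p + c) = p.+1.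
Proof. by move=> sc; rewrite size_polyDl size_polyXn. Qed.

Lemma disc_polyE y : f.[y] = (y ^+ p - y) ^+ 2 - 2%:R ^+ 2 * M.
Proof. by rewrite /f !hornerE. Qed.

Lemma size_disc : size f = (2 * p).+1.
Proof.
have szs : size (('X^p - 'X : {poly K}) ^+ 2) = (2 * p).+1.
  have s1 : size ('X^p - 'X : {poly K}) = p.+1.
    by rewrite szXp // size_polyN size_polyX.
  have := size_exp ('X^p - 'X : {poly K}) 2; rewrite s1 /= mulnC => <-.
  by rewrite prednK // size_poly_gt0 expf_neq0 // -size_poly_gt0 s1.
rewrite /f size_polyDl szs // size_polyN.
apply: leq_ltn_trans (size_polyC_leq1 _) _; rewrite ltnS muln_gt0 /=.
exact: prime_gt0.
Qed.

Lemma disc0 : f`_0 != 0.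
Proof.
rewrite -horner_coef0 disc_polyE expr0n eqn0Ngt prime_gt0 // subrr expr0n sub0r.
by rewrite oppr_eq0 mulf_neq0 // expf_neq0.
Qed.

(** The derivative is 2 (y - y^p), and where it vanishes the polynomial takes
    the value - 4m. Hence all roots are simple. *)
Lemma disc_simple : exists x, mup x f = 1%N.
Proof.
have /closed_rootP[x rx] : size f != 1%N.
  by rewrite size_disc eqSS muln_eq0 negb_or /= -lt0n prime_gt0 //.
have f0 : f != 0 by rewrite -size_poly_gt0 size_disc.
exists x; apply/eqP; rewrite eqn_leq -XsubC_dvd // dvdp_XsubCl rx andbT.
rewrite mup_leq //; apply/negP => /dvdpP[h hE].
have : f^`().[x] = 0.
  rewrite hE derivM deriv_exp /= derivB derivX derivC.
  by rewrite !(hornerD, hornerM, horner_exp, hornerMn, hornerN, hornerX, hornerC) subrr;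
    ring.
have -> : f^`().[x] = 2%:R * (x - x ^+ p).
  rewrite /f derivB derivC subr0 deriv_exp /= derivB derivXn derivX.
  have -> : 'X^(p.-1) *+ p = 0 :> {poly K}.
    by rewrite -mulr_natr -polyC_natr (pcharf0 charK) polyC0 mulr0.
  by rewrite !(hornerD, hornerM, horner_exp, hornerMn, hornerN, hornerX, hornerC); ring.
move/eqP; rewrite mulf_eq0 (negPf two0) subr_eq0 => /eqP xp.
move: rx; rewrite /root disc_polyE -xp subrr expr0n sub0r oppr_eq0.
by rewrite mulf_eq0 (negPf M0) orbF expf_eq0 (negPf two0) andbF.
Qed.

Definition trace0 n x := (x != 0) && (ptrace m (orbit_poly x n) == 0).

Section Level.
Variables (k : nat) (k3 : (3 <= k)%N).
Let n := (2 * k)%N.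
Let q := (p ^ n)%N.
Let l := (p ^ k)%N.
Let qE : q = (l ^ 2)%N.
Proof. by rewrite /q /n mulnC expnM. Qed.
Let n0 : (0 < n)%N.
Proof. by rewrite /n muln_gt0 /=; case: k k3. Qed.
Let odd_q : odd q.
Proof. by rewrite /q oddX odd_p orbT. Qed.

Let Q := Fq K p n.
Let N0 := count (trace0 n) Q.

Let memQ x : (x \in Q) = (x ^+ q == x).
Proof. exact: mem_Fq. Qed.

Let nonsq y := f.[y] ^+ (q.-1)./2 == -1.
Let issq y := f.[y] ^+ (q.-1)./2 == 1.
(** [link x y] says that y is a witness, as in Hilbert's Theorem 90, that x +
    m/x has trace zero. *)
Let link x y := (x != 0) && (x + M / x == y ^+ p - y).

Let qD (x y : K) : (x + y) ^+ q = x ^+ q + y ^+ q.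
Proof. exact: (frob_add charK n). Qed.

Let disc_q y : y \in Q -> f.[y] ^+ q = f.[y].
Proof.
rewrite memQ => /eqP yq.
have Mq : (- (2%:R ^+ 2 * M)) ^+ q = - (2%:R ^+ 2 * M).
  have := frob_emb charK emb n (- (2%:R ^+ 2 * m)).
  by rewrite /frob rmorphN rmorphM rmorphXn rmorph_nat.
rewrite disc_polyE qD Mq exprAC qD exprAC yq exprNn -signr_odd odd_q expr1 mulN1r yq.
by [].
Qed.

(** The values of the discriminant are nonsquares, zero, or nonzero squares. *)
Let classify : (q <= count nonsq Q + count (root f) Q + count issq Q)%N.
Proof.
rewrite -[q](size_Fq charK n0 : size Q = q) -sum1_size !count_sum -!big_split /=.
rewrite big_seq [X in (_ <= X)%N]big_seq; apply: leq_sum => y yQ.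
rewrite /nonsq /root /issq; have [//|fy] := eqVneq f.[y] 0; first by rewrite addnAC addn1.
have : (f.[y] ^+ (q.-1)./2) ^+ 2 == 1.
  rewrite -exprM muln2 (_ : _.*2 = q.-1)%N; last first.
    by rewrite -[RHS]odd_double_half; case: (q) odd_q => // r /= /negbTE ->.
  rewrite -(inj_eq (mulIf fy)) -exprSr prednK ?disc_q ?mul1r //.
  by rewrite expn_gt0 prime_gt0.
by rewrite sqrf_eq1 => /orP[] /eqP ->; rewrite eqxx ?addn1 // add1n.
Qed.

Let count_root : (count (root f) Q <= 2 * p)%N.
Proof.
rewrite -size_filter -ltnS -size_disc; apply: max_poly_roots.
- by rewrite -size_poly_gt0 size_disc.
- exact: filter_all.
by rewrite filter_uniq // uniq_Fq.
Qed.

Let count_nonsq : (2 * count nonsq Q <= q + 3 * p * l)%N.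
Proof.
have pk : (p ^ 2 + 2 * p < p ^ k)%N.
  apply: (@leq_trans (p ^ 3)); last by rewrite leq_exp2l.
  rewrite -mulnn !expnS expn0 muln1.
  case: p odd_p p1 => [|[|[|r]]] // _ _; clear; nia.
rewrite -size_filter qE.
apply: (@stepanov K p charK odd_p k p f odd_p pk size_disc disc0 disc_simple).
- by rewrite filter_uniq // uniq_Fq.
- by move=> y; rewrite mem_filter memQ qE => /andP[_ /eqP].
by move=> y; rewrite mem_filter /nonsq qE => /andP[/eqP].
Qed.

(** The quadratic formula, the square root of the discriminant being in the
    field with q elements. *)
Let two_links y : y \in Q -> issq y -> (2 <= count (link^~ y) Q)%N.
Proof.
move=> yQ /eqP Gy; have yq : y ^+ q = y by move: yQ; rewrite memQ => /eqP.
have [w] : exists w, root ('X^2 - (f.[y])%:P) w.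
  by apply/closed_rootP; rewrite size_XnsubC.
rewrite /root hornerD hornerN hornerXn hornerC subr_eq0 => /eqP w2.
have qq : q = (1 + 2 * (q.-1)./2)%N.
  rewrite mul2n -[LHS]odd_double_half odd_q.
  by case: (q) odd_q => //= r; rewrite uphalf_half => /negbTE ->.
have wq : w ^+ q = w by rewrite qq exprD exprM w2 Gy mulr1.
have w0 : w != 0.
  apply: contra_eq_neq Gy => w0; rewrite -w2 w0 expr0n /= expr0n.
  have q1 : (1 < q)%N by rewrite -(expn0 p) ltn_exp2l.
  have -> : ((q.-1)./2 == 0)%N = false by apply/negP => /eqP h; move: q1; rewrite qq h.
  by rewrite eq_sym oner_eq0.
pose a := y ^+ p - y.
have aq : a ^+ q = a.
  by rewrite /a qD exprAC yq exprNn -signr_odd odd_q expr1 mulN1r yq.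
have hq (x : K) : x ^+ q = x -> (x / 2%:R) ^+ q = x / 2%:R.
  move=> xq; rewrite exprMn xq exprVn; congr (_ / _).
  exact: (frob_nat charK n 2).
have Nwq : (- w) ^+ q = - w by rewrite exprNn -signr_odd odd_q expr1 mulN1r wq.
pose x1 := (a + w) / 2%:R; pose x2 := (a + - w) / 2%:R.
have x1Q : x1 \in Q by rewrite memQ /x1 hq // qD aq wq.
have x2Q : x2 \in Q by rewrite memQ /x2 hq // qD aq Nwq.
have x12 : x1 * x2 = M.
  move: w2; rewrite disc_polyE -/a => w2.
  have -> : x1 * x2 = (a ^+ 2 - w ^+ 2) / 2%:R ^+ 2 by rewrite /x1 /x2; field; rewrite four0 two0.
  by rewrite w2; field; rewrite ?four0 ?two0.
have s12 : x1 + x2 = a by rewrite /x1 /x2; field; rewrite ?four0 ?two0.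
have [x10 x20] : x1 != 0 /\ x2 != 0.
  by apply/andP; rewrite -negb_or -mulf_eq0 x12.
rewrite -size_filter; apply: (@uniq_leq_size _ [:: x1; x2]).
  rewrite /= inE andbT; apply/negP => /eqP E.
  have : x1 - x2 = w by rewrite /x1 /x2; field; rewrite ?four0 ?two0.
  by rewrite E subrr => /esym/eqP; rewrite (negPf w0).
move=> x; rewrite !inE mem_filter => /orP[]/eqP->; rewrite ?x1Q ?x2Q andbT /link.
  by rewrite x10 -x12 mulrAC divff // mul1r s12 eqxx.
by rewrite x20 -x12 mulfK // addrC s12 eqxx.
Qed.

(** The trace of y^p - y telescopes to zero, and y is determined by y^p - y
    up to p choices. *)
Let links_le x : x \in Q ->
  (count (link x) Q <= if trace0 n x then p else 0)%N.
Proof.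
move=> xQ; have [->|x0] := eqVneq x 0.
  by rewrite (eq_count (a2 := pred0)) ?count_pred0 // => y; rewrite /link eqxx.
have fx : frob p n x = x by apply/eqP; move: xQ; rewrite memQ.
have [|] := boolP (has (link x) Q); last by rewrite has_count -leqNgt leqn0 => /eqP ->.
case/hasP => y; rewrite memQ => /eqP yq /andP[_ /eqP xy].
rewrite /trace0; have -> : ptrace m (orbit_poly x n) == 0.
  rewrite -(fmorph_eq0 emb) emb_ptrace // xy.
  rewrite (eq_bigr (fun i : 'I_n => frob p i.+1 y - frob p i y)) => [|i _].
    rewrite -(big_mkord xpredT (fun i => frob p i.+1 y - frob p i y)).
    by rewrite telescope_sumr // /frob yq expr1 subrr.
  rewrite (frob_sub charK) /frob -exprM -expnS.
  by [].
rewrite x0 /= -size_filter -ltnS.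
pose c := x + M / x.
have szc : size ('X^p - 'X - c%:P : {poly K}) = p.+1.
  rewrite -addrA szXp //; apply: leq_trans (size_polyD _ _) _.
  by rewrite !size_polyN size_polyX geq_max p1 (leq_trans (size_polyC_leq1 _)) // ltnW.
rewrite -szc; apply: max_poly_roots; first by rewrite -size_poly_gt0 szc.
  apply/allP => z; rewrite mem_filter => /andP[/andP[_ /eqP E] _].
  by rewrite /root !hornerE /c E subrr.
by rewrite filter_uniq // uniq_Fq.
Qed.

(** Double counting of the pairs [link x y]: each of the at least q/2 - O(p
    l) values y with square discriminant has two partners, and each x of
    trace zero has at most p. *)
Lemma count_trace0 : (q <= p * N0 + 3 * p * l + 4 * p)%N.
Proof.
have H : (2 * count issq Q <= p * N0)%N.
  apply: (@leq_trans (\sum_(y <- Q | issq y) \sum_(x <- Q) link x y)).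
    rewrite -sum1_count big_distrr /= big_seq_cond [X in (_ <= X)%N]big_seq_cond.
    by apply: leq_sum => y /andP[yQ Gy]; rewrite -count_sum muln1 two_links.
  apply: (@leq_trans (\sum_(y <- Q) \sum_(x <- Q) link x y)).
    by rewrite [X in (_ <= X)%N](bigID issq) leq_addr.
  rewrite exchange_big /N0 count_sum big_distrr /= big_seq [X in (_ <= X)%N]big_seq.
  apply: leq_sum => x xQ; rewrite -count_sum; apply: leq_trans (links_le xQ) _.
  by case: ifP; rewrite ?muln1 ?muln0.
have := classify; have := count_root; have := count_nonsq; move: H.
rewrite -mulnA.
move: (count issq Q) (count nonsq Q) (count (root f) Q) (p * N0)%N (p * l)%N q.
by clear => a b c d e r; lia.
Qed.
End Level.
End Count.

(** * Weil's bound *)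

Section Lucas.
Variables (R : realType) (th : R).

(** The sequence alpha^k + alpha^(-k) with alpha + 1/alpha = th; it is
    computed with its successor to make the recursion structural. *)
Fixpoint lucas2 k : R * R :=
  if k is k'.+1 then let: (a, b) := lucas2 k' in (b, th * b - a) else (2, th).
Definition lucas k := (lucas2 k).1.

Lemma lucas2E k : lucas2 k = (lucas k, lucas k.+1).
Proof. by rewrite /lucas /=; case: (lucas2 k). Qed.

Lemma lucasSS k : lucas k.+2 = th * lucas k.+1 - lucas k.
Proof. by rewrite {1}/lucas /= lucas2E. Qed.

Lemma lucas_inv k : lucas k.+1 ^+ 2 - th * lucas k * lucas k.+1 + lucas k ^+ 2 = 4 - th ^+ 2.
Proof.
elim: k => [|k IH]; first by rewrite /lucas /=; ring.
by rewrite lucasSS -IH; ring.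
Qed.

(** For th = 2 cos t the sequence is 2 cos (k t). Algebraically, the
    quadratic form of [lucas_inv] is definite for |th| < 2 and confines the
    sequence to [-2, 2]. *)
Lemma lucas_ge k : -2 <= th <= 2 -> -2 <= lucas k.
Proof.
case/andP => th1 th2.
(* At the end points the quadratic form degenerates, and the sequence is
   explicit. *)
have [thE|thE] := eqVneq th 2.
  suff [-> _] : lucas k = 2 /\ lucas k.+1 = 2 by lra.
  by elim: k => [|k [IH1 IH2]]; [rewrite /lucas /= thE|rewrite lucasSS IH2 IH1 thE; split; lra].
have [thE'|thE'] := eqVneq th (-2).
  suff : (lucas k = 2 /\ lucas k.+1 = -2) \/ (lucas k = -2 /\ lucas k.+1 = 2).
    by case=> -[-> _]; lra.
  elim: k => [|k IH]; first by left; rewrite /lucas /= thE'.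
  by rewrite lucasSS thE'; case: IH => -[-> ->]; [right|left]; split; lra.
have h2 : th < 2 by rewrite lt_neqAle thE.
have h1 : -2 < th by rewrite lt_neqAle eq_sym thE'.
have := lucas_inv k; move: (lucas k) (lucas k.+1) => a b E.
have D : 0 < 4 - th ^+ 2 by nra.
have : (4 - th ^+ 2) * (a ^+ 2 - 4) <= 0.
  have -> : (4 - th ^+ 2) * (a ^+ 2 - 4) = - (2 * b - th * a) ^+ 2 +
      4 * (b ^+ 2 - th * a * b + a ^+ 2 - (4 - th ^+ 2)) by ring.
  by rewrite E subrr mulr0 addr0 oppr_le0 sqr_ge0.
rewrite pmulr_rle0 // => a4; nra.
Qed.

(** The increments never decrease, since lucas (k+2) - lucas (k+1) exceeds
    lucas (k+1) - lucas k by (th - 2) lucas (k+1). *)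
Lemma lucas_growth k : 2 < th -> 2 + k%:R * (th - 2) <= lucas k.
Proof.
move=> th2.
suff /andP[] : (2 + k%:R * (th - 2) <= lucas k) && (lucas k + (th - 2) <= lucas k.+1) by [].
elim: k => [|k /andP[IH1 IH2]]; first by rewrite /lucas /= mul0r; lra.
have k0 : 0 <= k%:R * (th - 2) by rewrite mulr_ge0 // subr_ge0 ltW.
rewrite lucasSS -natr1; apply/andP; split; first by lra.
nra.
Qed.
End Lucas.

Section Weil.
Local Open Scope complex_scope.
Variables (R : realType) (p : nat) (p_pr : prime p) (odd_p : odd p).
Variables (psi : 'F_p -> R[i]).
Hypotheses (psi0 : psi 0 = 1) (psiD : forall a b, psi (a + b) = psi a * psi b).
Hypothesis psi1 : psi 1 != 1.

(** The additive characters of the prime field; [twist c] is nontrivial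
    unless c is zero. *)
Let twist c (a : 'F_p) := psi (a * c).
Let twist0 c : twist c 0 = 1.
Proof. by rewrite /twist mul0r. Qed.
Let twistD c a b : twist c (a + b) = twist c a * twist c b.
Proof. by rewrite /twist mulrDl. Qed.
Let twist1 c : c != 0 -> twist c 1 != 1.
Proof.
rewrite /twist mul1r => c0; apply/negP => /eqP pc; move/eqP: psi1; apply.
have pcn n : psi (c *+ n) = 1.
  by elim: n => [|n IH]; rewrite ?mulr0n // mulrS psiD IH pc mulr1.
have := pcn (c^-1 : nat); rewrite -mulr_natr.
by rewrite natr_Zp mulfV.
Qed.

Variables (m : 'F_p) (m0 : m != 0).
Let S c := kloosterman_Fp m (twist c).

Lemma psi_conj a : ((psi a)^*)%R = psi (- a).
Proof.
have aN : psi a * psi (- a) = 1 by rewrite -psiD subrr.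
have n1 : `|psi a| = 1.
  apply/eqP; rewrite -(@pexpr_eq1 _ _ p) ?prime_gt0 // -normrX.
  have psiMn n : psi a ^+ n = psi (a *+ n).
    by elim: n => [|n IH]; rewrite ?expr0 ?mulr0n // exprS mulrS psiD IH.
  by rewrite psiMn -mulr_natr pchar_Fp_0 // mulr0 psi0 normr1.
have a0 : psi a != 0 by rewrite -normr_eq0 n1 oner_eq0.
by apply: (mulfI a0); rewrite aN -normCK n1 expr1n.
Qed.

(** Complex conjugation amounts to the substitution a |-> - a. *)
Lemma kloosterman_real c : S c \is Num.real.
Proof.
apply/CrealP; rewrite /S /kloosterman_Fp rmorph_sum (reindex_inj oppr_inj) /=.
apply: eq_big => [a|a _]; first by rewrite oppr_eq0.
by rewrite /twist psi_conj invrN mulrN -opprD mulNr opprK.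
Qed.

Let r c : R := complex.Re (S c).
Let SE c : S c = (r c)%:C.
Proof. by rewrite /r RRe_real // kloosterman_real. Qed.

Let P : R := p%:R.
Let P0 : 0 < P.
Proof. by rewrite /P ltr0n prime_gt0. Qed.
Let th c := (r c ^+ 2 - 2 * P) / P.

Let Pc : P%:C = p%:R.
Proof. by rewrite /P rmorph_nat. Qed.

Variables (K : closedFieldType) (charK : p \in [pchar K]) (emb : {rmorphism 'F_p -> K}).
Let La c n := kloosterman_Fq m (twist c) charK emb n.

(** The Kloosterman sum over the field with p^(2k) elements is - (alpha^(2k)
    + beta^(2k)), and alpha^2, beta^2 have product p^2 and sum K^2 - 2p = p
    th. *)
Lemma kloosterman_Fq_lucas c k : c != 0 -> La c (2 * k.+1) = - (P ^+ k.+1 * lucas (th c) k.+1)%:C.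
Proof.
move=> c0.
have rec n : La c n.+3 = - S c * La c n.+2 - p%:R * La c n.+1.
  exact: (kloosterman_Fq_rec p_pr m0 (twist0 c) (twistD c) (twist1 c0)).
have L1 : La c 1 = S c.
  exact: (kloosterman_Fq1 m (twist0 c) (twistD c)).
have L2 : La c 2 = 2 * p%:R - S c ^+ 2.
  exact: (kloosterman_Fq2 p_pr m0 (twist0 c) (twistD c) (twist1 c0)).
(* The recurrence satisfied by every second term. *)
have rec2 n : La c n.+1.+4 = (S c ^+ 2 - 2 * p%:R) * La c n.+3 - p%:R ^+ 2 * La c n.+1.
  rewrite (rec n.+2) (rec n.+1).
  have : La c n.+3 = - S c * La c n.+2 - p%:R * La c n.+1 := rec n.
  move: (La c n.+3) (La c n.+2) (La c n.+1) (S c) => l3 l2 l1 s E.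
  have -> : - s * (- s * l3 - p%:R * l2) - p%:R * l3 =
     (s ^+ 2 - 2 * p%:R) * l3 - p%:R ^+ 2 * l1 + p%:R * (l3 - (- s * l2 - p%:R * l1)) by ring.
  by rewrite E subrr mulr0 addr0.
pose t := (th c)%:C; pose lu j := (lucas (th c) j)%:C.
have tP : p%:R * t = S c ^+ 2 - 2 * p%:R.
  have castP (Q x y : R) : Q * x = y ^+ 2 - 2 * Q ->
      Q%:C * x%:C = y%:C ^+ 2 - 2 * Q%:C.
    move/(congr1 (real_complex R)).
    by rewrite rmorphM rmorphB rmorphXn rmorphM rmorph_nat.
  by rewrite -Pc SE; apply: castP; rewrite /th mulrC divfK // gt_eqF.
have luS j : lu j.+2 = t * lu j.+1 - lu j by rewrite /lu lucasSS rmorphB rmorphM.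
have lu0 : lu 0%N = 2 by rewrite /lu /lucas /= rmorph_nat.
have lu1 : lu 1%N = t by [].
have castE j : (P ^+ j * lucas (th c) j)%:C = p%:R ^+ j * lu j.
  by rewrite rmorphM rmorphXn /= Pc.
rewrite castE.
have L2' : La c 2 = - (p%:R * lu 1%N) by rewrite L2 lu1 tP; ring.
have L4 : La c 4 = - (p%:R ^+ 2 * lu 2%N).
  have -> : p%:R ^+ 2 * lu 2%N = (p%:R * t) ^+ 2 - 2 * p%:R ^+ 2.
    by rewrite luS lu1 lu0; move: (t) => u; ring.
  rewrite (rec 1%N) (rec 0%N) L1 L2 tP. by move: (S c) (p%:R : R[i]) => s u; ring.
suff [] : La c (2 * k.+1) = - (p%:R ^+ k.+1 * lu k.+1) /\
  La c (2 * k.+2) = - (p%:R ^+ k.+2 * lu k.+2) by [].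
elim: k => [|k [IH1 IH2]]; first by rewrite expr1.
split=> //; rewrite (_ : 2 * k.+3 = (2 * k).+1.+1.+4)%N; last by clear; lia.
rewrite rec2 (_ : (2 * k).+4 = 2 * k.+2)%N; last by clear; lia.
rewrite (_ : (2 * k).+2 = 2 * k.+1)%N; last by clear; lia.
by rewrite IH1 IH2 (luS k.+1) -tP !exprS; move: (t) (lu _) (lu _) => u v w; ring.
Qed.

Lemma count_nonzero n : (0 < n)%N ->
  (count (fun x : K => x != 0%R) (Fq K p n) = (p ^ n).-1)%N.
Proof.
move=> n0; rewrite -(size_Fq charK n0).
have := count_predC (pred1 0) (Fq K p n); rewrite -[count (pred1 0) _]/(count_mem 0 _).
rewrite count_uniq_mem ?(uniq_Fq charK) // (mem_Fq charK) //.
have -> : frob p n (0 : K) == 0 by rewrite /frob expr0n expn_eq0 eqn0Ngt prime_gt0.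
by move=> <-.
Qed.

(** Orthogonality of characters; the trivial character, excluded from the
    sum, counts all the nonzero x. *)
Lemma sum_kloosterman_Fq n : (0 < n)%N ->
  \sum_(c | c != 0) La c n = p%:R * (count (trace0 m charK emb n) (Fq K p n))%:R -
    ((p ^ n).-1)%:R.
Proof.
move=> n0.
have L0 : ((p ^ n).-1)%:R = La 0 n.
  rewrite -count_nonzero // count_sum natr_sum /La /kloosterman_Fq big_seq [RHS]big_seq.
  apply: eq_bigr => x; rewrite (mem_Fq charK) // => /eqP fx.
  rewrite /kl_weight coef0_orbit_poly_eq0 //; case: eqP => //= _.
  by rewrite /twist mulr0 psi0.
have E : \sum_c La c n = p%:R * (count (trace0 m charK emb n) (Fq K p n))%:R.
  rewrite /La /kloosterman_Fq exchange_big /= count_sum natr_sum mulr_sumr.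
  rewrite big_seq [RHS]big_seq; apply: eq_bigr => x.
  rewrite (mem_Fq charK) // => /eqP fx.
  rewrite /kl_weight /trace0 coef0_orbit_poly_eq0 //; case: eqP => [_|/eqP x0] /=.
    by rewrite big1 ?mulr0.
  rewrite /twist; under eq_bigr do rewrite mulrC.
  by rewrite sum_psiM //; case: eqP; rewrite ?mulr1 ?mulr0.
by rewrite -E [in RHS](bigD1 0) //= L0 addrC addrK.
Qed.

(** The left side is - p^(-k) times the sum in [sum_kloosterman_Fq], which
    [count_trace0] bounds from below. *)
Lemma lucas_sum_le k : (3 <= k)%N ->
  \sum_(c | c != 0) lucas (th c) k <= 7 * P.
Proof.
move=> k3; have k0 : (0 < k)%N by apply: leq_trans k3.
have n0 : (0 < 2 * k)%N by rewrite muln_gt0.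
have := sum_kloosterman_Fq n0.
rewrite (eq_bigr (fun c => - (P ^+ k * lucas (th c) k)%:C)); last first.
  by move=> c c0; rewrite -[in LHS](prednK k0) kloosterman_Fq_lucas // prednK.
rewrite sumrN -rmorph_sum -mulr_sumr /= -!(rmorph_nat (real_complex R)) -rmorphM -rmorphB -rmorphN.
move/complexI; have := count_trace0 p_pr odd_p m0 charK emb k3.
move: (count _ _) (\sum_(c | _) _) => N s H E.
have Pk : 0 < P ^+ k by rewrite exprn_gt0.
have Pk1 : 1 <= P ^+ k by rewrite exprn_ege1 // /P ler1n prime_gt0.
rewrite -(ler_pM2l Pk).
have : - (P ^+ k * s) >= - (3 * P * P ^+ k + 4 * P).
  rewrite E -/P; move: H; rewrite -(ler_nat R) !natrD !natrM !natrX -/P.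
  have : ((p ^ (2 * k)).-1)%:R <= P ^+ (2 * k) by rewrite /P -natrX ler_nat leq_pred.
  lra.
have PX : P <= P * P ^+ k by rewrite ler_peMr // ltW.
rewrite lerN2 => H2; apply: le_trans H2 _; rewrite mulrCA; lra.
Qed.

(** Otherwise the term of c in [lucas_sum_le] is unbounded in k, while the
    other terms are at least -2: the quantity th d + 2 = r(d)^2 / p is
    nonnegative because Kloosterman sums are real. *)
Lemma weil_theta c : c != 0 -> th c <= 2.
Proof.
move=> c0; rewrite leNgt; apply/negP => th2.
have thge d : -2 <= th d.
  rewrite /th ler_pdivlMr // mulNr; have := sqr_ge0 (r d); lra.
have lge d k : -2 <= lucas (th d) k.
  have [h|h] := leP (th d) 2; first by apply: lucas_ge; rewrite thge h.
  apply: le_trans (lucas_growth k h); have : 0 <= k%:R * (th d - 2).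
    by rewrite mulr_ge0 // subr_ge0 ltW.
  lra.
have bound k : (3 <= k)%N -> k%:R * (th c - 2) <= 9 * P.
  move=> k3; have := lucas_sum_le k3; rewrite (bigD1 c) //= => H.
  have : \sum_(i | (i != 0) && (i != c)) (-2 : R) <= \sum_(i | (i != 0) && (i != c)) lucas (th i) k.
    by apply: ler_sum => i _; exact: lge.
  have : - (2 * P) <= \sum_(i : 'F_p | (i != 0) && (i != c)) (-2 : R).
    rewrite sumr_const -[X in _ <= X]mulr_natr mulNr lerN2 ler_pM2l // /P ler_nat.
    by rewrite -[leqRHS](card_Fp p_pr) max_card.
  have := lucas_growth k th2; lra.
have := archi_boundP (_ : 0 <= 9 * P / (th c - 2)).
set B := Num.bound _ => /(_ _)/wrap[]; first by rewrite divr_ge0 ?mulr_ge0 ?ltW // subr_gt0.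
rewrite ltr_pdivrMr ?subr_gt0 // => HB.
have := bound (B + 3)%N (leq_addl _ _); rewrite natrD mulrDl.
have : 0 < 3%:R * (th c - 2) by rewrite mulr_gt0 // subr_gt0.
lra.
Qed.
End Weil.

Theorem weil_bound (R : realType) (p : nat) (psi : 'F_p -> R[i]) (m : 'F_p) :
  prime p -> odd p -> psi 0 = 1 -> (forall a b, psi (a + b) = psi a * psi b) ->
  psi 1 != 1 -> m != 0 -> `|kloosterman_Fp m psi| ^+ 2 <= (4 * p)%:R.
Proof.
move=> p_pr odd_p psi0 psiD psi1 m0.
have [K [emb _]] := countable_algebraic_closure 'F_p.
have charK : p \in [pchar K] by rewrite (fmorph_pchar emb) pchar_Fp.
have := weil_theta p_pr odd_p psi0 psiD psi1 m0 charK emb (oner_neq0 _).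
have Kreal := kloosterman_real p_pr psi0 psiD m 1.
have E : kloosterman_Fp m (fun a => psi (a * 1)) = kloosterman_Fp m psi.
  by apply: eq_bigr => a _; rewrite mulr1.
rewrite E in Kreal *; rewrite real_normK // -(RRe_real Kreal).
set r := complex.Re _; have P0 : 0 < (p%:R : R) by rewrite ltr0n prime_gt0.
rewrite ler_pdivrMr // => H.
rewrite -rmorphXn -(rmorph_nat (real_complex R)) /= lecR natrM; lra.
Qed.

(** * Multiplicativity of Kloosterman sums *)

(** The Kloosterman sum with frequencies h and k over the modular hyperbola x
    y = c, for an n-th root of unity z. The arguments are natural numbers, so
    that the moduli can be multiplied and divided without casts. *)
Definition Kl (C : pzSemiRingType) (z : C) (n c h k : nat) : C :=
  \sum_(x < n) \sum_(y < n | (x * y == c %[mod n])%N) z ^+ (h * x + k * y).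

Lemma coprime_solve n x c : (0 < n)%N -> coprime x n ->
  exists2 y, (y < n)%N & x * y = c %[mod n].
Proof.
move=> n0 cxn; case: (posnP x) => [x0|x0].
  move: cxn; rewrite x0 /coprime gcd0n => /eqP ->.
  by exists 0%N => //; rewrite !modn1.
case: (egcdnP n x0) => u v E _; exists ((u * c) %% n)%N; first by rewrite ltn_mod.
rewrite modnMmr mulnA [(x * u)%N]mulnC E (eqP cxn) mulnDl mul1n.
by rewrite -mulnA [(n * c)%N]mulnC mulnA modnMDl.
Qed.

Lemma coprime_cancel n x y y' : coprime x n -> x * y = x * y' %[mod n] ->
  y = y' %[mod n].
Proof.
move=> cxn; wlog le : y y' / (y' <= y)%N => [H|].
  by case: (leqP y' y) => [/H//|/ltnW/H H' /esym/H']; exact.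
move/eqP; rewrite eqn_mod_dvd ?leq_mul2l ?le ?orbT // -mulnBr.
rewrite Gauss_dvdr; last by rewrite coprime_sym.
by rewrite -eqn_mod_dvd // => /eqP.
Qed.

Lemma coprime_of_mul n x y c : coprime c n -> x * y = c %[mod n] -> coprime x n.
Proof.
by move=> cn E; move: cn; rewrite -coprime_modl -E coprime_modl coprimeMl => /andP[].
Qed.

(** For x prime to n, the hyperbola has exactly one point with abscissa x. *)
Lemma Kl_inner (C : nmodType) (f : nat -> C) n x y c :
  (0 < n)%N -> coprime x n -> x * y = c %[mod n] ->
  \sum_(i < n | (x * i == c %[mod n])%N) f i = f (y %% n)%N.
Proof.
move=> n0 cxn E.
rewrite (big_pred1 (Ordinal (ltn_pmod y n0))) // => i /=.
apply/eqP/eqP => [E'|->]; last by rewrite /= modnMmr.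
apply: val_inj; rewrite /= -(modn_small (ltn_ord i)).
by apply: (coprime_cancel cxn); rewrite E' E.
Qed.

Lemma Kl_inner0 (C : nmodType) (f : nat -> C) n x c :
  coprime c n -> ~~ coprime x n -> \sum_(i < n | (x * i == c %[mod n])%N) f i = 0.
Proof.
move=> cn ncx; rewrite big_pred0 // => i; apply/negP => /eqP E.
by move/negP: ncx; apply; apply: coprime_of_mul cn E.
Qed.

Section Reduction.
Variables (C : comPzSemiRingType) (z : C) (n p c h k : nat).
Hypotheses (n0 : (0 < n)%N) (p0 : (0 < p)%N) (pn : (p %| n)%N) (cn : coprime c n).
Hypothesis zn : z ^+ (n * p) = 1.

Let copM x : coprime x (n * p) = coprime x n.
Proof.
rewrite coprimeMr andb_idr //; case/dvdnP: pn => r ->.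
by rewrite coprimeMr => /andP[].
Qed.

(** As p divides n, the points of the hyperbola modulo n p lie over those
    modulo n, and p of them over each; the summand depends only on the point
    modulo n. *)
Lemma Kl_reduce : Kl z (n * p) c (p * h) (p * k) = p%:R * Kl (z ^+ p) n c h k.
Proof.
have np0 : (0 < n * p)%N by rewrite muln_gt0 n0.
pose w := z ^+ p; have wn : w ^+ n = 1 by rewrite -exprM mulnC.
have wmod i : w ^+ (i %% n) = w ^+ i by rewrite expr_mod.
pose T x := \sum_(y < n | (x * y == c %[mod n])%N) w ^+ (k * y).
have Tmod x : T (x %% n)%N = T x by apply: eq_bigl => y; rewrite modnMml.
have inner x : \sum_(y < n * p | (x * y == c %[mod n * p])%N) w ^+ (k * y) = T x.
  have [cx|cx] := boolP (coprime x n); last first.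
    by rewrite /T !(@Kl_inner0 _ (fun y => w ^+ (k * y))) ?copM.
  have [y _ E] : exists2 y, (y < n * p)%N & x * y = c %[mod n * p].
    by apply: coprime_solve; rewrite ?copM.
  have E' : x * y = c %[mod n].
    by rewrite -(modn_dvdm (x * y) (dvdn_mulr p (dvdnn n))) E modn_dvdm ?dvdn_mulr.
  rewrite (@Kl_inner _ (fun y => w ^+ (k * y)) _ _ _ _ _ _ E) ?copM //.
  rewrite /T (@Kl_inner _ (fun y => w ^+ (k * y)) _ _ _ _ _ _ E') //.
  by rewrite -wmod -[RHS]wmod -[in LHS]modnMmr modn_dvdm ?dvdn_mulr.
have outer : Kl z (n * p) c (p * h) (p * k) = \sum_(x < n * p) w ^+ (h * x) * T x.
  apply: eq_bigr => x _; rewrite -inner mulr_sumr; apply: eq_bigr => y _.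
  by rewrite -!mulnA -mulnDr exprM exprD.
rewrite outer -(big_mkord xpredT (fun x => w ^+ (h * x) * T x)) mulnC.
rewrite big_nat_mul (eq_bigr (fun=> Kl w n c h k)) => [|i _].
  by rewrite sumr_const_nat subn0 mulr_natl.
rewrite -{1}[(i * n)%N]add0n big_addn mulSn addnK big_mkord.
apply: eq_bigr => x _; rewrite -Tmod addnC modnMDl Tmod [in LHS]addnC.
rewrite mulr_sumr; apply: eq_bigr => y _; rewrite exprD; congr (_ * _).
by rewrite ![(h * _)%N]mulnC !exprM -[w ^+ (x + _)]wmod addnC modnMDl wmod.
Qed.
End Reduction.

Section CRT.
Variables (C : comNzRingType) (z : C) (n1 n2 c h k : nat).
Hypotheses (n10 : (0 < n1)%N) (n20 : (0 < n2)%N) (cn12 : coprime n1 n2).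
Hypothesis zn : z ^+ (n1 * n2) = 1.

Let n := (n1 * n2)%N.
Let n0 : (0 < n)%N. Proof. by rewrite muln_gt0 n10. Qed.
Definition crt_join (u : 'I_n1 * 'I_n2) : 'I_n :=
  Ordinal (ltn_pmod (n2 * u.1 + n1 * u.2) n0).

Lemma modn_mulP a b : (a == b %[mod n]) = (a == b %[mod n1]) && (a == b %[mod n2]).
Proof. exact: chinese_remainder. Qed.

Let mod1 u : crt_join u = n2 * u.1 %[mod n1].
Proof. by rewrite /crt_join /= modn_dvdm ?dvdn_mulr // addnC mulnC modnMDl. Qed.
Let mod2 u : crt_join u = n1 * u.2 %[mod n2].
Proof. by rewrite /crt_join /= modn_dvdm ?dvdn_mull // mulnC modnMDl. Qed.

Let mul1 u v : crt_join u * crt_join v = n2 ^ 2 * (u.1 * v.1) %[mod n1].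
Proof. by rewrite -modnMml mod1 -modnMmr mod1 modnMml modnMmr; congr modn; ring. Qed.
Let mul2 u v : crt_join u * crt_join v = n1 ^ 2 * (u.2 * v.2) %[mod n2].
Proof. by rewrite -modnMml mod2 -modnMmr mod2 modnMml modnMmr; congr modn; ring. Qed.

Lemma crt_join_bij : bijective crt_join.
Proof.
apply: inj_card_bij; last by rewrite card_prod !card_ord.
move=> [x1 x2] [y1 y2] E.
have E1 : n2 * x1 = n2 * y1 %[mod n1].
  by rewrite -(mod1 (x1, x2)) E (mod1 (y1, y2)).
have E2 : n1 * x2 = n1 * y2 %[mod n2].
  by rewrite -(mod2 (x1, x2)) E (mod2 (y1, y2)).
congr (_, _); apply: val_inj.
  rewrite /= -(modn_small (ltn_ord x1)) -[RHS](modn_small (ltn_ord y1)).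
  by apply: coprime_cancel E1; rewrite coprime_sym.
rewrite /= -(modn_small (ltn_ord x2)) -[RHS](modn_small (ltn_ord y2)).
exact: coprime_cancel E2.
Qed.

(** In x = n2 x1 + n1 x2 the powers of z separate, and the equation x y = c
    reads n2^2 x1 y1 = c modulo n1 and n1^2 x2 y2 = c modulo n2. *)
Lemma Kl_crt c1 c2 : n2 ^ 2 * c1 = c %[mod n1] -> n1 ^ 2 * c2 = c %[mod n2] ->
  Kl z n c h k = Kl (z ^+ n2) n1 c1 h k * Kl (z ^+ n1) n2 c2 h k.
Proof.
move=> C1 C2.
have KlE (z' : C) m d : Kl z' m d h k =
   \sum_(u : 'I_m * 'I_m) (u.1 * u.2 == d %[mod m])%:R * z' ^+ (h * u.1 + k * u.2).
  rewrite /Kl; under eq_bigr do rewrite big_mkcond /=.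
  rewrite pair_bigA /=; apply: eq_bigr => u _; case: ifP; by rewrite ?mul1r ?mul0r.
rewrite !KlE.
have jj : bijective (fun w : ('I_n1 * 'I_n1) * ('I_n2 * 'I_n2) =>
   (crt_join (w.1.1, w.2.1), crt_join (w.1.2, w.2.2))).
  have [g gK Kg] := crt_join_bij.
  exists (fun xy => (((g xy.1).1, (g xy.2).1), ((g xy.1).2, (g xy.2).2))).
    by move=> [[a b] [a' b']] /=; rewrite !gK.
  by move=> [x y] /=; rewrite -!surjective_pairing !Kg.
rewrite (reindex _ (onW_bij _ jj)) /=.
rewrite mulr_suml; under [RHS]eq_bigr do rewrite mulr_sumr.
rewrite pair_bigA /=; apply: eq_bigr => -[[x1 y1] [x2 y2]] _ /=.
rewrite mulrACA -natrM mulnb; congr (_%:R * _).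
  rewrite modn_mulP; congr nat_of_bool; congr andb.
    have /= E1 := mul1 (x1, x2) (y1, y2); rewrite E1 -C1.
    apply/eqP/eqP => [|E]; last by rewrite -modnMmr E modnMmr.
    by apply: coprime_cancel; rewrite coprimeXl // coprime_sym.
  have /= E2 := mul2 (x1, x2) (y1, y2); rewrite E2 -C2.
  apply/eqP/eqP => [|E]; last by rewrite -modnMmr E modnMmr.
  by apply: coprime_cancel; rewrite coprimeXl.
have zE a b : z ^+ (a * (b %% n)) = z ^+ (a * b).
  by rewrite ![(a * _)%N]mulnC !exprM expr_mod.
rewrite /crt_join /= exprD !zE -!exprM -!exprD; congr (z ^+ _); ring.
Qed.
End CRT.

(** * Averaging a Kloosterman sum over a congruence class *)

Section Zn.
Variables (C : numClosedFieldType) (n : nat) (n1 : (1 < n)%N) (z : C).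
Hypothesis prim_z : n.-primitive_root z.
Local Notation A := 'Z_n.

Definition zchar (a : A) : C := z ^+ a.
Local Notation psi := zchar.

Lemma zchar_nat i : psi i%:R = z ^+ i.
Proof. by rewrite /psi val_Zp_nat // (prim_expr_mod prim_z). Qed.

Lemma zcharD a b : psi (a + b) = psi a * psi b.
Proof. by rewrite -[a]natr_Zp -[b]natr_Zp -natrD !zchar_nat exprD. Qed.

Lemma zchar0 : psi 0 = 1.
Proof. by rewrite /psi expr0. Qed.

Lemma zchar_eq1 a : (psi a == 1) = (a == 0).
Proof.
rewrite -{1}[a]natr_Zp zchar_nat -(prim_order_dvd prim_z).
rewrite -{2}[a]natr_Zp -(inj_eq val_inj) /= val_Zp_nat //.
Qed.

Lemma norm_zchar a : `|psi a| = 1.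
Proof.
apply/eqP; rewrite -(@pexpr_eq1 _ _ n) ?(ltnW n1) // -normrX -exprM mulnC exprM.
by rewrite (prim_expr_order prim_z) expr1n normr1.
Qed.

Lemma zchar_conj a : (psi a)^* = psi (- a).
Proof.
have a0 : psi a != 0 by rewrite -normr_eq0 norm_zchar oner_eq0.
by apply: (mulfI a0); rewrite -normCK norm_zchar expr1n -zcharD subrr zchar0.
Qed.

Lemma sum_zchar g : \sum_s psi (g * s) = if g == 0 then n%:R else 0.
Proof.
case: eqP => [->|/eqP g0].
  under eq_bigr do rewrite mul0r zchar0.
  by rewrite sumr_const card_ord Zp_cast.
apply: (@sum_char _ _ (fun s => psi (g * s)) 1) => [a b|].
  by rewrite mulrDr zcharD.
by rewrite mulr1 zchar_eq1.
Qed.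

Lemma natr_Zn_eq i j : ((i%:R : A) == j%:R) = (i == j %[mod n]).
Proof. by rewrite -(inj_eq val_inj) /= !val_Zp_nat. Qed.

Lemma unit_Zn (x : A) : (x \is a GRing.unit) = coprime x n.
Proof. by rewrite -{1}[x]natr_Zp unitZpE // coprime_sym. Qed.

(** The hyperbola is parametrized by the units x, with y = c / x. *)
Lemma Kl_Zn c h k : coprime c n ->
  Kl z n c h k = \sum_(x : A | x \is a GRing.unit) psi (h%:R * x + k%:R * c%:R / x).
Proof.
move=> cn; pose T x := \sum_(y < n | (x * y == c %[mod n])%N) z ^+ (h * x + k * y).
have -> : Kl z n c h k = \sum_(x : A) T x.
  rewrite /Kl -(big_mkord xpredT T) -[in LHS](Zp_cast n1) big_mkord //.
rewrite [RHS]big_mkcond; apply: eq_bigr => x _; rewrite unit_Zn.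
case: ifP => cx; last first.
  exact: (@Kl_inner0 C (fun y => z ^+ (h * x + k * y)) n x c cn (negbT cx)).
have ux : x \is a GRing.unit by rewrite unit_Zn.
pose y : A := c%:R / x.
have E : x * y = c %[mod n].
  by apply/eqP; rewrite -natr_Zn_eq natrM !natr_Zp /y mulrC divrK.
have := @Kl_inner C (fun y => z ^+ (h * x + k * y)) n x y c (ltnW n1) cx E.
rewrite -/(T x) => ->.
have <- : (h * x + k * y)%:R = h%:R * x + k%:R * c%:R / x :> A.
  by rewrite natrD !natrM !natr_Zp mulrA.
rewrite zchar_nat modn_small //.
by rewrite -[X in (_ < X)%N](Zp_cast n1).
Qed.

Lemma Kl_trivial c h k : coprime c n ->
  `|Kl z n c h k| <= (#|[pred x : A | x \is a GRing.unit]|)%:R.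
Proof.
move=> cn; rewrite Kl_Zn //; apply: le_trans (ler_norm_sum _ _ _) _.
by rewrite (eq_bigr (fun=> 1)) => [|x _]; rewrite ?sumr_const // norm_zchar.
Qed.

(** Let pi^3 = 0. Then 1 + pi t is a unit for all t, with inverse 1 - pi t +
    pi^2 t^2, and the substitution x |-> x (1 + pi t) leaves the sum
    unchanged. Averaging over t replaces each summand by a multiple of the
    quadratic sum [G x] in t. With pi^2 rho = 0, the shift of t by rho only
    affects the linear term. *)
Section Average.
Variables (pi rho H K' : A).
Hypotheses (pi3 : pi ^+ 3 = 0) (pir : pi ^+ 2 * rho = 0).

Let S := \sum_(x : A | x \is a GRing.unit) psi (H * x + K' / x).
Let alpha x := H * x - K' / x.
Let beta x := K' / x.
Let G x := \sum_t psi (pi * t * alpha x + pi ^+ 2 * t ^+ 2 * beta x).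
Let u t := 1 + pi * t.
Let v t := 1 - pi * t + pi ^+ 2 * t ^+ 2.

Definition stationary := [pred x : A | (x \is a GRing.unit) &&
  (pi * rho * (H * x - K' / x) == 0)].
Definition degenerate := [pred w : A | 2 * pi ^+ 2 * w == 0].

Let uv t : u t * v t = 1.
Proof.
have -> : u t * v t = 1 + pi ^+ 3 * t ^+ 3 by rewrite /u /v; ring.
by rewrite pi3 mul0r addr0.
Qed.

(** For each t, expand the phase H x u + K' / (x u) with u = 1 + pi t. *)
Lemma average_eq : n%:R * S = \sum_(x : A | x \is a GRing.unit) psi (H * x + K' / x) * G x.
Proof.
have St t : S = \sum_(x : A | x \is a GRing.unit) psi (H * x + K' / x) *
    psi (pi * t * alpha x + pi ^+ 2 * t ^+ 2 * beta x).
  have uu : u t \is a GRing.unit by apply/unitrP; exists (v t); rewrite mulrC uv.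
  rewrite /S (reindex_inj (mulIr uu)) /=.
  apply: eq_big => [x|x]; rewrite unitrM uu andbT // => ux.
  rewrite -zcharD; congr psi; rewrite invrM // (_ : (u t)^-1 = v t); last first.
    by apply: (mulrI uu); rewrite uv mulrV.
  by rewrite /alpha /beta /u /v; ring.
under eq_bigr do rewrite mulr_sumr.
rewrite exchange_big /= -(eq_bigr _ (fun t _ => St t)) sumr_const card_ord Zp_cast //.
by rewrite mulr_natl.
Qed.

(** The shift t |-> t + rho multiplies [G x] by the value of the character at
    pi rho alpha x, and the character is 1 only at 0. *)
Lemma quad_sum_neq0 x : G x != 0 -> pi * rho * alpha x = 0.
Proof.
move=> Gx; apply/eqP; apply: contraNT Gx => al0.
have [s /negPf ps] : exists s, psi (pi * rho * alpha x * s) != 1.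
  by exists 1; rewrite mulr1 zchar_eq1.
have : (psi (pi * rho * alpha x * s) - 1) * G x = 0.
  rewrite mulrBl mul1r [X in _ - X](reindex_inj (addrI (rho * s))) /= mulr_sumr.
  apply/eqP; rewrite subr_eq0; apply/eqP/eq_bigr => t _.
  rewrite -zcharD; congr psi.
  have -> : pi * (rho * s + t) * alpha x + pi ^+ 2 * (rho * s + t) ^+ 2 * beta x =
     pi * rho * alpha x * s + (pi * t * alpha x + pi ^+ 2 * t ^+ 2 * beta x) +
     (pi ^+ 2 * rho) * (s * (rho * s + 2 * t) * beta x) by ring.
  by rewrite pir mul0r addr0.
by move/eqP; rewrite mulf_eq0 subr_eq0 ps /=.
Qed.

(** Squaring out and shifting t by s, the phase becomes linear in s with
    slope 2 pi^2 beta x w; as beta x is a unit, only the [w] annihilated by 2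
    pi^2 contribute. *)
Lemma norm_quad_sum_le x : beta x \is a GRing.unit ->
  `|G x| ^+ 2 <= (n * #|degenerate|)%:R.
Proof.
move=> bu; pose Q t := pi * t * alpha x + pi ^+ 2 * t ^+ 2 * beta x.
have E : `|G x| ^+ 2 = \sum_w psi (Q w) * (if 2 * pi ^+ 2 * w == 0 then n%:R else 0).
  rewrite normCK rmorph_sum /= mulr_sumr.
  transitivity (\sum_s \sum_w psi (Q w) * psi (2 * pi ^+ 2 * beta x * w * s)).
    apply: eq_bigr => s _; rewrite /G (reindex_inj (addrI s)) /= mulr_suml.
    apply: eq_bigr => w _; rewrite zchar_conj -!zcharD; congr psi; rewrite /Q; ring.
  rewrite exchange_big; apply: eq_bigr => w _; rewrite -mulr_sumr sum_zchar.
  rewrite (_ : 2 * pi ^+ 2 * beta x * w = (2 * pi ^+ 2 * w) * beta x); last by ring.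
  by rewrite (mulIr_eq0 _ (mulIr bu)).
have -> : `|G x| ^+ 2 = `| `|G x| ^+ 2 | by rewrite [RHS]normrX normr_id.
rewrite {}E; apply: le_trans (ler_norm_sum _ _ _) _.
rewrite natrM mulr_natr -[leRHS]sumr_const [leRHS]big_mkcond /=.
apply: ler_sum => w _; rewrite normrM norm_zchar mul1r inE.
by case: ifP; rewrite ?normr0 ?normr_nat.
Qed.

(** Only the stationary points contribute to the average, each at most the
    bound of [norm_quad_sum_le]; that bound asks for a unit K' as soon as
    there is such a point. *)
Lemma average_bound (N B : nat) :
  (#|stationary| <= N)%N ->
  (#|degenerate| <= B)%N ->
  (K' \is a GRing.unit \/ N = 0%N) ->
  `|S| ^+ 2 * n%:R <= (N ^ 2 * B)%:R.
Proof.
move=> hN hB hK.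
have nS : n%:R * `|S| <= \sum_(x in stationary) `|G x|.
  rewrite -[n%:R]normr_nat -normrM average_eq.
  apply: le_trans (ler_norm_sum _ _ _) _.
  rewrite [leRHS]big_mkcond [leLHS]big_mkcond; apply: ler_sum => x _; rewrite inE.
  case: (x \is a GRing.unit) => //=; rewrite normrM norm_zchar mul1r.
  have [->|/quad_sum_neq0 ->] := eqVneq (G x) 0; last by rewrite eqxx.
  by case: ifP; rewrite normr0.
have n0 : 0 < n%:R :> C by rewrite ltr0n ltnW.
have nS0 : 0 <= n%:R * `|S| by rewrite mulr_ge0.
case: hK => [uK|N0]; last first.
  have S0 : n%:R * `|S| = 0.
    apply/eqP; rewrite eq_le nS0 andbT; apply: le_trans nS _; rewrite big_pred0 // => x.
    move: hN; rewrite N0 leqn0 => /eqP/card0_eq/(_ x). by [].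
  have -> : `|S| = 0 by move/eqP: S0; rewrite mulf_eq0 gt_eqF // => /eqP.
  by rewrite expr0n mul0r ler0n.
pose M : C := sqrtC (n * B)%:R.
have M0 : 0 <= M by rewrite sqrtC_ge0 ler0n.
have GM x : x \in stationary -> `|G x| <= M.
  rewrite inE => /andP[ux _]; rewrite -(@ler_pXn2r _ 2) ?nnegrE // sqrtCK.
  apply: le_trans (norm_quad_sum_le _) _; first by rewrite unitrM uK unitrV ux.
  by rewrite ler_nat leq_mul2l hB orbT.
have nSM : n%:R * `|S| <= N%:R * M.
  apply: le_trans nS _; apply: le_trans (ler_sum _ GM) _.
  by rewrite sumr_const -[leLHS]mulr_natl ler_wpM2r // ler_nat.
have : (n%:R * `|S|) ^+ 2 <= (N%:R * M) ^+ 2.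
  by rewrite ler_pXn2r ?nnegrE // mulr_ge0.
rewrite !exprMn sqrtCK => nS2; rewrite -(ler_pM2l n0).
have -> : n%:R * (`|S| ^+ 2 * n%:R) = n%:R ^+ 2 * `|S| ^+ 2 by ring.
by apply: le_trans nS2 _; rewrite !natrM le_eqVlt; apply/orP; left; apply/eqP; ring.
Qed.
End Average.
End Zn.

(** * Prime powers with exponent at least two *)

Definition annihilator n c := [pred u : 'Z_n | c%:R * u == 0].

(** If n divides c u with u < n, then u is determined by the quotient c u /
    n, which is less than c. *)
Lemma card_annihilator n c : (1 < n)%N -> (0 < c)%N -> (#|annihilator n c| <= c)%N.
Proof.
move=> n1 c0.
have nZ (u : 'Z_n) : (u < n)%N by have := ltn_ord u; rewrite [X in (_ < X)%N -> _]Zp_cast.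
have lt (u : 'Z_n) : (c * u %/ n < c)%N.
  by rewrite ltn_divLR ?(ltnW n1) // ltn_pmul2l // nZ.
rewrite -[X in (_ <= X)%N]card_ord.
rewrite -(@card_in_image _ _ (fun u => Ordinal (lt u))) ?max_card // => u v.
have ann w : c%:R * w == 0 :> 'Z_n -> (n %| c * w)%N.
  move=> cw; have : (c * w)%:R == 0 :> 'Z_n by rewrite natrM natr_Zp.
  by rewrite -(inj_eq val_inj) /= val_Zp_nat.
move=> hu hv [E]; have uE := divnK (ann _ hu); have vE := divnK (ann _ hv).
apply: val_inj; apply/eqP; rewrite /= -(eqn_pmul2l c0); apply/eqP.
by rewrite -uE -vE E.
Qed.

Section PrimePower.
Variables (p e : nat) (p_pr : prime p) (e2 : (2 <= e)%N).
Let q := (p ^ e)%N.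
Local Notation A := 'Z_(p ^ e).
Let p0 : (0 < p)%N := prime_gt0 p_pr.
Let q1 : (1 < q)%N.
Proof. by rewrite -(expn0 p) ltn_exp2l ?prime_gt1 // ltnW. Qed.

Lemma unit_Zpe (x : A) : (x \is a GRing.unit) = ~~ (p %| x)%N.
Proof.
by rewrite unit_Zn // coprime_sym coprime_pexpl ?prime_coprime // ltnW.
Qed.

Lemma unit_Zpe_nat i : ((i%:R : A) \is a GRing.unit) = ~~ (p %| i)%N.
Proof.
by rewrite unitZpE // coprime_pexpl ?prime_coprime // ltnW.
Qed.

Lemma unit_add (a b : A) : a + b \is a GRing.unit ->
  (a \is a GRing.unit) || (b \is a GRing.unit).
Proof.
rewrite -[a]natr_Zp -[b]natr_Zp -natrD !unit_Zpe_nat -negb_and.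
by apply: contra => /andP[pa pb]; rewrite dvdn_add.
Qed.

Let j := (e./2).
Let j1 : (1 <= j)%N. Proof. by rewrite /j; case: e e2 => [|[|e']]. Qed.
Let je : (2 * j <= e)%N. Proof. by rewrite /j mul2n -{2}(odd_double_half e) leq_addl. Qed.
Let ej : (e <= 3 * j)%N.
Proof.
rewrite -{1}(odd_double_half e) -/j -muln2; move: j1; case: (odd e); clear; lia.
Qed.
(** With e <= 3 j, where j is half of e rounded down, [pi] has cube zero. *)
Let pi : A := (p ^ j)%:R.
Let rho : A := (p ^ (e - 2 * j))%:R.

Let natr_pe_eq0 i : ((p ^ i)%:R == 0 :> A) = (e <= i)%N.
Proof.
rewrite -(inj_eq val_inj) /= val_Zp_nat // -/(dvdn _ _) dvdn_Pexp2l //.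
exact: prime_gt1.
Qed.

Let pi3 : pi ^+ 3 = 0.
Proof. by apply/eqP; rewrite /pi -natrX -expnM natr_pe_eq0 mulnC. Qed.
Let pir : pi ^+ 2 * rho = 0.
Proof.
by apply/eqP; rewrite /pi /rho -natrX -natrM -expnM -expnD natr_pe_eq0 mulnC subnKC.
Qed.
Let kappaE : pi * rho = (p ^ (e - j))%:R.
Proof. by rewrite -natrM -expnD; congr ((p ^ _)%:R); move: je; clear; lia. Qed.

Section Counts.
Variables (H K' : A).
Local Notation stat := (stationary pi rho H K').

(** Then H x - K' / x is a unit, which the nonzero class pi rho = p^(e-j)
    cannot annihilate. *)
Lemma stationary_nonunit : (H \is a GRing.unit) (+) (K' \is a GRing.unit) ->
  #|stat| = 0%N.
Proof.
move=> HK; apply: eq_card0 => x; rewrite inE; apply/negP => /andP[ux].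
suff ual : H * x - K' / x \is a GRing.unit.
  rewrite (mulIr_eq0 _ (mulIr ual)) kappaE natr_pe_eq0 leqNgt.
  by rewrite -subn_gt0 subKn ?j1 //; move: je; clear; lia.
have uHx : (H * x \is a GRing.unit) = (H \is a GRing.unit) by rewrite unitrM ux andbT.
have uKx : (K' / x \is a GRing.unit) = (K' \is a GRing.unit).
  by rewrite unitrM unitrV ux andbT.
move: HK; have [uH|uH] := boolP (H \is a GRing.unit).
  move=> /= nK; have := @unit_add (H * x - K' / x) (K' / x); rewrite subrK uHx uKx.
  by rewrite (negbTE nK) orbF => /(_ uH).
move=> /= uK; have := @unit_add (H * x) (K' / x - H * x); rewrite subrKC uHx uKx.
by rewrite (negbTE uH) -[H * x - _]opprB unitrN => /(_ uK).
Qed.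

(** Stationary points solve H x^2 = K' modulo p^j, so the difference of two
    squares is annihilated by p^(e-j). *)
Lemma stationary_mul x x' : H \is a GRing.unit -> x \in stat -> x' \in stat ->
  (p ^ (e - j))%:R * ((x - x') * (x + x')) = 0 :> A.
Proof.
move=> uH; rewrite !inE kappaE => /andP[ux /eqP sx] /andP[ux' /eqP sx'].
have k2 y : y \is a GRing.unit -> (p ^ (e - j))%:R * (H * y - K' / y) = 0 ->
    (p ^ (e - j))%:R * (H * y ^+ 2 - K') = 0.
  move=> uy E; have -> : (p ^ (e - j))%:R * (H * y ^+ 2 - K') =
    (p ^ (e - j))%:R * (H * y - K' / y) * y.
    by rewrite -mulrA mulrBl divrK // -mulrA -expr2.
  by rewrite E mul0r.
apply: (mulrI uH); rewrite mulr0.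
have -> : H * ((p ^ (e - j))%:R * ((x - x') * (x + x'))) =
  (p ^ (e - j))%:R * (H * x ^+ 2 - K') - (p ^ (e - j))%:R * (H * x' ^+ 2 - K') by ring.
by rewrite !k2 // subrr.
Qed.

(** All stationary points lie within c-torsion of one of them, up to sign. *)
Lemma card_stationary c : (0 < c)%N ->
  (forall x x', x \in stat -> x' \in stat ->
     (c%:R * (x - x') == 0) || (c%:R * (x + x') == 0)) ->
  (#|stat| <= 2 * c)%N.
Proof.
move=> c0 Hc; have [/existsP[x' sx']|] := boolP [exists x, x \in stat]; last first.
  by rewrite negb_exists => /forallP H0; rewrite eq_card0 // => x; apply/negbTE.
pose ann := [set u : A | c%:R * u == 0].
have annc : (#|ann| <= c)%N.
  by rewrite cardsE; exact: card_annihilator.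
apply: (@leq_trans #|[set x' + u | u in ann] :|: [set u - x' | u in ann]|).
  apply/subset_leq_card/fintype.subsetP => x sx; rewrite inE; apply/orP.
  case/orP: (Hc _ _ sx sx') => E; [left|right]; apply/imsetP.
    by exists (x - x'); rewrite ?inE // subrKC.
  by exists (x + x'); rewrite ?inE // addrK.
apply: leq_trans (leq_card_setU _ _) _; rewrite mul2n -addnn.
by apply: leq_add; apply: leq_trans (leq_imset_card _ _) annc.
Qed.

(** x - x' and x + x' cannot both be divisible by p, as their sum 2 x is a
    unit; so one of them can be cancelled in [stationary_mul]. *)
Lemma card_stationary_odd : odd p -> H \is a GRing.unit -> (#|stat| <= 2 * p ^ (e - j))%N.
Proof.
move=> podd uH; apply: card_stationary; first by rewrite expn_gt0 p0.
move=> x x' sx sx'; have E := stationary_mul uH sx sx'.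
have ux : x \is a GRing.unit by move: sx; rewrite inE => /andP[].
have u2 : (2%:R : A) \is a GRing.unit.
  by rewrite unit_Zpe_nat dvdn_prime2 //; apply: contraTneq podd => ->.
have : (x - x') + (x + x') \is a GRing.unit.
  by rewrite (_ : _ + _ = 2%:R * x) ?unitrM ?u2 //; ring.
case/unit_add/orP => u; apply/orP; [right|left]; apply/eqP; apply: (mulrI u).
  by rewrite mulr0 -E; ring.
by rewrite mulr0 -E; ring.
Qed.

(** Now both factors x - x' and x + x' are even, but their halves a and b
    have the unit x as sum; the two factors 2 cost one factor 2 in the
    torsion. *)
Lemma card_stationary_2 : p = 2%N -> H \is a GRing.unit -> (#|stat| <= 2 * (2 * p ^ (e - j)))%N.
Proof.
move=> p2 uH; apply: card_stationary; first by rewrite muln_gt0 expn_gt0 p0.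
move=> x x' sx sx'; have E := stationary_mul uH sx sx'.
have oddu y : y \in stat -> y \is a GRing.unit /\ odd y.
  rewrite inE => /andP[uy _]; split=> //; move: uy.
  by rewrite unit_Zpe; apply: contraR; rewrite -dvdn2; move: (nat_of_ord y) => v; rewrite p2.
have [ux ox] := oddu _ sx; have [_ ox'] := oddu _ sx'.
pose b : A := ((x + x')./2)%:R; pose a := x - b.
have bE : x + x' = 2%:R * b.
  rewrite -natrM mul2n -[(_./2.*2)%N]add0n.
  have <- : odd (x + x') = 0%N :> nat by rewrite oddD ox ox'.
  by rewrite odd_double_half natrD !natr_Zp.
have aE : x - x' = 2%:R * a.
  have -> : 2%:R * a = 2%:R * x - 2%:R * b by rewrite /a; ring.
  by rewrite -bE; ring.
rewrite natrM; have : a + b \is a GRing.unit by rewrite subrK.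
rewrite aE bE in E *.
case/unit_add/orP => u; apply/orP; [right|left]; apply/eqP; apply: (mulrI u).
  by rewrite mulr0 -E; ring.
by rewrite mulr0 -E; ring.
Qed.
End Counts.

Lemma card_degenerate_odd : odd p -> (#|degenerate pi| <= p ^ (2 * j))%N.
Proof.
move=> podd; apply: leq_trans (card_annihilator q1 (_ : 0 < p ^ (2 * j))%N); last first.
  by rewrite expn_gt0 p0.
apply/subset_leq_card/fintype.subsetP => w; rewrite !inE /pi -natrX -expnM mulnC -mulrA.
have u2 : (2%:R : A) \is a GRing.unit.
  by rewrite unit_Zpe_nat dvdn_prime2 //; apply: contraTneq podd => ->.
by rewrite (mulrI_eq0 _ (mulrI u2)).
Qed.

Lemma card_degenerate_2 : (#|degenerate pi| <= 2 * p ^ (2 * j))%N.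
Proof.
apply: leq_trans (card_annihilator q1 (_ : 0 < 2 * p ^ (2 * j))%N); last first.
  by rewrite muln_gt0 expn_gt0 p0.
apply/subset_leq_card/fintype.subsetP => w.
by rewrite !inE /pi -natrX -expnM [(j * 2)%N]mulnC natrM.
Qed.

Variables (C : numClosedFieldType) (z : C).
Hypothesis prim_z : q.-primitive_root z.

(** The square of the number of stationary points times the number of
    degenerate classes is at most 4 q^2 for odd p and 32 q^2 for p = 2. The
    latter is at most (e+1)^2 q^2 for e >= 5, and for 2 <= e <= 4 the trivial
    bound q^2 is at most (e+1)^2 q. *)
Lemma Kl_prime_power_unit c h k : coprime c q -> ~~ ((p %| h) && (p %| k))%N ->
  `|Kl z q c h k| ^+ 2 <= ((e.+1) ^ 2 * q)%:R.
Proof.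
move=> cq nhk.
have q0 : 0 < q%:R :> C by rewrite ltr0n ltnW.
pose H : A := h%:R; pose K' : A := k%:R * c%:R.
have uc : (c%:R : A) \is a GRing.unit by rewrite unitZpE // coprime_sym.
have uH : (H \is a GRing.unit) = ~~ (p %| h)%N by rewrite unit_Zpe_nat.
have uK : (K' \is a GRing.unit) = ~~ (p %| k)%N.
  by rewrite unitrM uc andbT unit_Zpe_nat.
have SE := Kl_Zn q1 prim_z h k cq.
have bound (N B : nat) : (#|stationary pi rho H K'| <= N)%N ->
   (#|degenerate pi| <= B)%N -> (K' \is a GRing.unit \/ N = 0%N) ->
   (N ^ 2 * B <= e.+1 ^ 2 * q * q)%N -> `|Kl z q c h k| ^+ 2 <= ((e.+1) ^ 2 * q)%:R.
  move=> h1 h2 h3 h4; rewrite -(ler_pM2r q0) -natrM SE.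
  apply: le_trans (average_bound q1 prim_z pi3 pir h1 h2 h3) _.
  by rewrite ler_nat.
have [HK|HK] := boolP ((H \is a GRing.unit) (+) (K' \is a GRing.unit)).
  have s0 := stationary_nonunit HK.
  by apply: (bound 0%N _ _ (leqnn _)); rewrite ?s0 //; right.
have {}uH : H \is a GRing.unit.
  by move: HK nhk; rewrite uH uK; do 2!case: (p %| _)%N.
have {}uK : K' \is a GRing.unit by move: HK; rewrite uH /= negbK.
have ee : (p ^ (e - j) * p ^ (e - j) * p ^ (2 * j) = q * q)%N.
  by rewrite /q -!expnD; congr (p ^ _)%N; move: je; clear; lia.
case: (even_prime p_pr) => [p2|podd].
  have [e4|e5] := leqP e 4.
    have : `|Kl z q c h k| <= q%:R.
      apply: le_trans (Kl_trivial q1 prim_z h k cq) _; rewrite ler_nat.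
      by apply: leq_trans (max_card _) _; rewrite card_ord Zp_cast.
    rewrite -(@ler_pXn2r _ 2) ?nnegrE // => /le_trans; apply.
    rewrite -natrX ler_nat -mulnn leq_mul2r; apply/orP; right; rewrite /q p2.
    by case: e e2 e4 => [|[|[|[|[|e']]]]].
  apply: (bound _ _ (card_stationary_2 K' p2 uH) card_degenerate_2); first by left.
  have -> : ((2 * (2 * p ^ (e - j))) ^ 2 * (2 * p ^ (2 * j)) = 32 * (q * q))%N.
    by rewrite -ee -mulnn; ring.
  rewrite -mulnA leq_mul2r; apply/orP; right.
  apply: (@leq_trans (6 ^ 2)) => //; by rewrite leq_exp2r.
apply: (bound _ _ (card_stationary_odd K' podd uH) (card_degenerate_odd podd)); first by left.
have -> : ((2 * p ^ (e - j)) ^ 2 * p ^ (2 * j) = 4 * (q * q))%N.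
  by rewrite -ee -mulnn; ring.
rewrite -mulnA leq_mul2r; apply/orP; right.
by apply: (@leq_trans (2 ^ 2)) => //; rewrite leq_exp2r // ltnW // ltnS.
Qed.
End PrimePower.

(** * Kloosterman sums to an arbitrary modulus *)

Lemma leq_gcdn_mul g a b : (0 < a * b)%N -> coprime a b ->
  (gcdn g a * gcdn g b <= gcdn g (a * b))%N.
Proof.
move=> ab0 cab; apply: dvdn_leq; first by rewrite gcdn_gt0 ab0 orbT.
rewrite Gauss_dvd; last first.
  by apply: coprime_dvdl (dvdn_gcdr _ _) _; apply: coprime_dvdr (dvdn_gcdr _ _) _.
by rewrite !dvdn_gcd !dvdn_gcdl /= dvdn_mulr ?dvdn_gcdr // dvdn_mull ?dvdn_gcdr.
Qed.

Lemma leq_tau_pfactor p e : prime p -> (e.+1 <= size (divisors (p ^ e)))%N.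
Proof.
move=> p_pr; rewrite -[e.+1](size_iota 0) -(size_map (fun i => p ^ i)%N).
apply: uniq_leq_size.
  by rewrite map_inj_uniq ?iota_uniq // => i j /eqP; rewrite eqn_exp2l ?prime_gt1 // => /eqP.
move=> d /mapP[u]; rewrite mem_iota add0n ltnS => ue ->.
by rewrite -dvdn_divisors ?expn_gt0 ?prime_gt0 // dvdn_exp2l.
Qed.

Lemma leq_tau_mul a b : (0 < a)%N -> (0 < b)%N -> coprime a b ->
  (size (divisors a) * size (divisors b) <= size (divisors (a * b)))%N.
Proof.
move=> a0 b0 cab; rewrite -(size_allpairs muln); apply: uniq_leq_size.
  apply: allpairs_uniq; rewrite ?divisors_uniq // => -[d1 d2] [d1' d2'].
  move=> /allpairsPdep[x1 [x2 [h1 h2 [-> ->]]]] /allpairsPdep[y1 [y2 [h1' h2' [-> ->]]]] /= E.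
  move: h1 h2 h1' h2'; rewrite -!dvdn_divisors // => h1 h2 h1' h2'.
  have g1 x y : (x %| a)%N -> (y %| b)%N -> gcdn (x * y) a = x.
    move=> xa yb; rewrite gcdnC mulnC Gauss_gcdr; first by apply/gcdn_idPr.
    exact: coprime_dvdr yb cab.
  have E1 : x1 = y1 by rewrite -(g1 x1 x2) // E g1.
  move: E; rewrite E1 => /eqP; rewrite eqn_pmul2l => [/eqP -> //|].
  by case: (y1) h1' => //; rewrite dvd0n gtn_eqF.
move=> d /allpairsP[[x y] /= [xa yb ->]]; move: xa yb.
by rewrite -!dvdn_divisors ?muln_gt0 ?a0 // => xa yb; apply: dvdn_mul.
Qed.

Section Bound.
Variable R : realType.
Local Notation C := (R[i]).

Lemma Kl_le_n (n : nat) (z : C) c h k : (1 < n)%N -> n.-primitive_root z -> coprime c n ->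
  `|Kl z n c h k| ^+ 2 <= (n ^ 2)%:R.
Proof.
move=> n1 pz cn; rewrite natrX ler_pXn2r ?nnegrE //.
apply: le_trans (Kl_trivial n1 pz h k cn) _; rewrite ler_nat.
by apply: leq_trans (max_card _) _; rewrite card_ord Zp_cast.
Qed.

(** If exactly one of h and k is divisible by p, the sum degenerates to a
    character sum over the nonzero classes, with value -1. For p = 2 the
    trivial bound is enough. *)
Lemma Kl_prime p (z : C) c h k : prime p -> p.-primitive_root z -> coprime c p ->
  `|Kl z p c h k| ^+ 2 <= (4 * gcdn (gcdn h k) p * p)%:R.
Proof.
move=> p_pr pz cp; have p0 := prime_gt0 p_pr; have p1 := prime_gt1 p_pr.
have g0 : (0 < gcdn (gcdn h k) p)%N by rewrite gcdn_gt0 p0 orbT.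
case: (even_prime p_pr) => [p2|podd].
  apply: le_trans (Kl_le_n h k p1 pz cp) _; rewrite ler_nat -mulnn.
  rewrite leq_mul2r; apply/orP; right; apply: (@leq_trans 4); first by rewrite p2.
  by rewrite leq_pmulr.
have [phk|nphk] := boolP ((p %| h) && (p %| k))%N.
  apply: le_trans (Kl_le_n h k p1 pz cp) _; rewrite ler_nat.
  have /gcdn_idPr -> : (p %| gcdn h k)%N by rewrite dvdn_gcd.
  by rewrite -mulnn leq_mul2r leq_pmull ?orbT.
apply: (@le_trans _ _ (4 * p)%:R); last by rewrite ler_nat leq_mul2r leq_pmulr ?orbT.
(* By definition the field with p elements consists of the classes modulo
   [pdiv p]. *)
have pp : pdiv p = p := pdiv_id p_pr.
have pz' : (pdiv p).-primitive_root z by rewrite pp.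
have P1 : (1 < pdiv p)%N by rewrite pp.
have -> : Kl z p c h k = Kl z (pdiv p) c h k by rewrite pp.
rewrite (Kl_Zn P1 pz'); last by rewrite pp.
pose psi : 'F_p -> C := zchar z.
have psi0 : psi 0 = 1 by rewrite /psi zchar0.
have psiD a b : psi (a + b) = psi a * psi b := zcharD P1 pz' a b.
have psi_eq1 a : (psi a == 1) = (a == 0) := zchar_eq1 P1 pz' a.
have psi1 : psi 1 != 1 by rewrite psi_eq1 oner_eq0.
pose H : 'F_p := h%:R; pose K' : 'F_p := k%:R * c%:R.
have nat0 i : ((i%:R : 'F_p) == 0) = (p %| i)%N by rewrite -(dvdn_pcharf (pchar_Fp p_pr)).
have K0 : (K' == 0) = (p %| k)%N.
  rewrite mulf_eq0 !nat0; case: (p %| k)%N => //=; apply/negbTE.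
  by rewrite -prime_coprime // coprime_sym.
have H0 : (H == 0) = (p %| h)%N := nat0 h.
have -> : \sum_(x in GRing.unit) psi (H * x + K' / x) =
  \sum_(x : 'F_p | x != 0) psi (H * x + K' / x).
  by apply: eq_bigl => x; exact: unitfE.
rewrite -H0 -K0 in nphk.
have sum1 (g : 'F_p) : g != 0 -> \sum_(x : 'F_p | x != 0) psi (x * g) = -1.
  move=> gn0; have := sum_psiM p_pr psi0 psiD psi1 g; rewrite (negbTE gn0) (bigD1 0) //=.
  by rewrite mul0r psi0 => /eqP; rewrite addrC addr_eq0 => /eqP.
have one : (1 : C) <= (4 * p)%:R by rewrite ler1n muln_gt0 p0.
have [H00|H00] := eqVneq H 0.
  rewrite H00 eqxx /= in nphk.
  rewrite (reindex_inj invr_inj) /=.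
  under eq_bigl do rewrite invr_eq0.
  under eq_bigr do rewrite H00 mul0r add0r invrK mulrC.
  by rewrite sum1 // normrN1 expr1n.
have [K00|K00] := eqVneq K' 0.
  under eq_bigr do rewrite K00 mul0r addr0 mulrC.
  by rewrite sum1 // normrN1 expr1n.
have m0 : K' * H != 0 by rewrite mulf_neq0.
have -> : \sum_(x : 'F_p | x != 0) psi (H * x + K' / x) = kloosterman_Fp (K' * H) psi.
  rewrite /kloosterman_Fp [RHS](reindex_inj (mulfI H00)) /=.
  apply: eq_big => [x|x x0]; first by rewrite mulf_eq0 negb_or H00.
  by congr psi; rewrite invfM; congr (_ + _); rewrite mulrA mulrK ?unitfE.
exact: weil_bound.
Qed.

(** A common factor p of h and k comes out of the sum as a factor p by
    [Kl_reduce], which contributes p^2 = p * p to the square, once in the gcd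
    and once in the modulus. *)
Lemma Kl_prime_power p e (z : C) c h k : prime p -> (0 < e)%N ->
  (p ^ e).-primitive_root z -> coprime c (p ^ e) ->
  `|Kl z (p ^ e) c h k| ^+ 2 <= (e.+1 ^ 2 * gcdn (gcdn h k) (p ^ e) * p ^ e)%:R.
Proof.
move=> p_pr; have p0 := prime_gt0 p_pr.
elim: e z h k => // -[|e] IH z h k _.
  by rewrite !expn1 => pz cp; exact: Kl_prime.
move=> pz cp; have q0 i : (0 < p ^ i)%N by rewrite expn_gt0 p0.
have [/andP[/dvdnP[h' hE] /dvdnP[k' kE]]|nphk] := boolP ((p %| h) && (p %| k))%N; last first.
  apply: le_trans (Kl_prime_power_unit p_pr _ pz cp nphk) _ => //.
  by rewrite ler_nat leq_mul2r leq_pmulr ?orbT // gcdn_gt0 q0 orbT.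
have cp' : coprime c (p ^ e.+1) by move: cp; rewrite !coprime_pexpr.
have pz' : (p ^ e.+1).-primitive_root (z ^+ p).
  have pdv : (p %| p ^ e.+2)%N by rewrite dvdn_exp.
  have dE : (p ^ e.+2 %/ p = p ^ e.+1)%N by rewrite expnS mulKn.
  by have := exp_prim_root pz p; rewrite (gcdn_idPl pdv) dE.
rewrite mulnC in hE; rewrite mulnC in kE.
have zq : z ^+ (p ^ e.+1 * p) = 1 by rewrite -expnSr (prim_expr_order pz).
have pq : (p %| p ^ e.+1)%N by rewrite dvdn_exp.
have -> : Kl z (p ^ e.+2) c h k = p%:R * Kl (z ^+ p) (p ^ e.+1) c h' k'.
  by rewrite hE kE expnSr; exact: Kl_reduce.
rewrite hE kE.
rewrite normrM exprMn normr_nat.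
apply: le_trans (ler_wpM2l _ (IH _ h' k' isT pz' cp')) _; first by rewrite exprn_ge0.
rewrite -natrX -natrM ler_nat -muln_gcdr [(p ^ e.+2)%N]expnS -muln_gcdr.
  have : (e.+2 ^ 2 <= e.+3 ^ 2)%N by rewrite leq_exp2r.
  set g := gcdn _ (p ^ e.+1); set Q := (p ^ e.+1)%N.
  move: (e.+2 ^ 2)%N (e.+3 ^ 2)%N => u v uv.
  have -> : (p ^ 2 * (u * g * Q) = u * (p * g * (p * Q)))%N by rewrite -mulnn; ring.
  by rewrite -[leqRHS]mulnA leq_mul2r uv orbT.
Qed.

Theorem Kl_bound n (z : C) c h k : (0 < n)%N -> n.-primitive_root z -> coprime c n ->
  `|Kl z n c h k| ^+ 2 <= (size (divisors n) ^ 2 * gcdn (gcdn h k) n * n)%:R.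
Proof.
elim/ltn_ind: n z c => n IH z c n0 pz cn.
have [n1|n1] := leqP n 1.
  have {n1 n0} nE : n = 1%N by apply/eqP; rewrite eqn_leq n1.
  rewrite nE in pz *; rewrite /Kl big_ord1 big_mkcond big_ord1 /= !modn1 eqxx !muln0.
  by rewrite expr0 normr1 expr1n gcdn1.
pose p := pdiv n; have p_pr : prime p by rewrite pdiv_prime.
pose e := logn p n; pose n2 := (n`_p^')%N.
have e0 : (0 < e)%N by rewrite logn_gt0 mem_primes p_pr n0 pdiv_dvd.
have nE : n = (p ^ e * n2)%N by rewrite -p_part /n2 partnC.
have n20 : (0 < n2)%N by rewrite part_gt0.
have q0 : (0 < p ^ e)%N by rewrite expn_gt0 prime_gt0.
have cq : coprime (p ^ e) n2 by rewrite -p_part /n2 coprime_partC.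
have q1 : (1 < p ^ e)%N by rewrite -(expn0 p) ltn_exp2l ?prime_gt1.
have lt2 : (n2 < n)%N by rewrite nE -{1}[n2]mul1n ltn_pmul2r.
rewrite nE in pz cn *.
have [c1 _ C1] : exists2 y, (y < p ^ e)%N & n2 ^ 2 * y = c %[mod p ^ e].
  by apply: coprime_solve => //; rewrite coprimeXl // coprime_sym.
have [c2 _ C2] : exists2 y, (y < n2)%N & (p ^ e) ^ 2 * y = c %[mod n2].
  by apply: coprime_solve => //; rewrite coprimeXl.
have /andP[cn1 cn2] : coprime c (p ^ e) && coprime c n2 by rewrite -coprimeMr.
have cc1 : coprime c1 (p ^ e) by apply: (coprime_of_mul cn1); rewrite mulnC; exact: C1.
have cc2 : coprime c2 n2 by apply: (coprime_of_mul cn2); rewrite mulnC; exact: C2.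
have pz1 : (p ^ e).-primitive_root (z ^+ n2).
  by have := exp_prim_root pz n2; rewrite (gcdn_idPl (dvdn_mull _ (dvdnn _))) mulnK.
have pz2 : n2.-primitive_root (z ^+ (p ^ e)).
  by have := exp_prim_root pz (p ^ e); rewrite (gcdn_idPl (dvdn_mulr _ (dvdnn _))) mulKn.
rewrite (Kl_crt h k q0 n20 cq (prim_expr_order pz) C1 C2) normrM exprMn.
have B1 := Kl_prime_power h k p_pr e0 pz1 cc1.
have B2 := IH n2 lt2 _ _ n20 pz2 cc2.
apply: le_trans (ler_pM _ _ B1 B2) _; rewrite ?exprn_ge0 // -natrM ler_nat.
have T : (e.+1 * size (divisors n2) <= size (divisors (p ^ e * n2)))%N.
  by apply: leq_trans (leq_tau_mul _ _ cq) => //; rewrite leq_mul2r leq_tau_pfactor ?orbT.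
have G : (gcdn (gcdn h k) (p ^ e) * gcdn (gcdn h k) n2 <= gcdn (gcdn h k) (p ^ e * n2))%N.
  by apply: leq_gcdn_mul; rewrite ?muln_gt0 ?q0.
have T2 : ((e.+1 * size (divisors n2)) ^ 2 <= size (divisors (p ^ e * n2)) ^ 2)%N.
  by rewrite leq_exp2r.
apply: leq_trans (leq_mul (leq_mul T2 G) (leqnn (p ^ e * n2))).
by rewrite leq_eqVlt -!mulnn; apply/orP; left; apply/eqP; ring.
Qed.
End Bound.

(** * Reduction to the sawtooth function *)

Section Hyperbola.
Variables (n m : nat) (n1 : (1 < n)%N) (cmn : coprime m n).
Let n0 : (0 < n)%N := ltnW n1.

Lemma sum_hyperbola1 (V : nmodType) (f : nat -> V) :
  \sum_(a < n) \sum_(b < n | (a * b == m %[mod n])%N) f a = \sum_(a < n | coprime a n) f a.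
Proof.
rewrite [RHS]big_mkcond; apply: eq_bigr => a _.
case: ifP => [ca|/negbT nca]; last exact: (@Kl_inner0 V (fun=> f a)).
have [b _ E] := coprime_solve m n0 ca.
exact: (@Kl_inner V (fun=> f a) _ _ _ _ n0 ca E).
Qed.

Lemma sum_hyperbola2 (V : nmodType) (f : nat -> V) :
  \sum_(a < n) \sum_(b < n | (a * b == m %[mod n])%N) f b = \sum_(a < n | coprime a n) f a.
Proof.
rewrite (exchange_big_dep xpredT) //= -sum_hyperbola1.
by apply: eq_bigr => b _; apply: eq_bigl => a; rewrite mulnC.
Qed.

Lemma sum_odd_reflection (V : fieldType) (P : pred nat) (f : nat -> V) :
  2%:R != 0 :> V ->
  (forall a, (0 < a < n)%N -> P (n - a)%N = P a /\ f (n - a)%N = - f a) ->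
  \sum_(1 <= a < n | P a) f a = 0.
Proof.
move=> V2 fodd; apply: (mulIf V2); rewrite mul0r mulr_natr mulr2n.
rewrite {1}big_nat_rev /= add1n.
rewrite (_ : \sum_(1 <= a < n | P (n.+1 - a.+1)%N) f (n.+1 - a.+1)%N =
             - \sum_(1 <= a < n | P a) f a) ?addNr // -sumrN.
rewrite big_nat_cond [RHS]big_nat_cond; apply: eq_big => a.
  by case: (boolP (1 <= a < n)%N) => //= an; rewrite subSS (fodd a an).1.
by case/andP=> an _; rewrite subSS (fodd a an).2.
Qed.

Lemma coprime_subn a : (a <= n)%N -> coprime (n - a) n = coprime a n.
Proof.
move=> an; rewrite /coprime -{2 3}(subnKC an) gcdnDl gcdnDr.
by rewrite gcdnC.
Qed.

(** The range 1, ..., n may be replaced by 0, ..., n-1: neither 0 nor n is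
    prime to n. *)
Lemma S2_hyperbola : S2 n m = (\sum_(a < n) \sum_(b < n | a * b == m %[mod n]) a * b)%N.
Proof.
rewrite S2E //.
have out a : ~~ coprime a n -> (\sum_(1 <= b < n.+1 | (a * b == m %[mod n])%N) a * b = 0)%N.
  move=> nca; rewrite big_pred0 // => b; apply/negP => /eqP E.
  by move/negP: nca; apply; apply: coprime_of_mul cmn E.
have ncn : ~~ coprime n n by rewrite /coprime gcdnn neq_ltn n1 orbT.
have nc0 : ~~ coprime 0 n by rewrite /coprime gcd0n neq_ltn n1 orbT.
rewrite big_nat_recr //= out // addn0.
rewrite -(big_mkord xpredT (fun a => \sum_(b < n | (a * b == m %[mod n])%N) a * b)%N).
rewrite [RHS]big_ltn // [X in _ = (X + _)%N]big1 ?add0n => [|b _]; last by rewrite mul0n.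
apply: eq_bigr => a _.
rewrite -(big_mkord (fun b => (a * b == m %[mod n])%N) (fun b => a * b)%N).
rewrite [LHS]big_mkcond [RHS]big_mkcond big_nat_recr //= [RHS]big_ltn //.
rewrite !muln0 if_same add0n ifF ?addn0 //; apply/negP => /eqP E.
by move/negP: ncn; apply; apply: (coprime_of_mul cmn); rewrite mulnC; exact: E.
Qed.

Variable R : realFieldType.
Definition saw (a : nat) : R := a%:R / n%:R - 1 / 2.

Lemma saw_sub a : (a <= n)%N -> saw (n - a) = - saw a.
Proof.
have N0 : n%:R != 0 :> R by rewrite pnatr_eq0 -lt0n.
by move=> an; rewrite /saw natrB //; field.
Qed.

Lemma S2_saw : (S2 n m)%:R - 1 / 4 * n%:R ^+ 2 * (totient n)%:R =
  n%:R ^+ 2 * \sum_(a < n) \sum_(b < n | (a * b == m %[mod n])%N) saw a * saw b.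
Proof.
have N0 : n%:R != 0 :> R by rewrite pnatr_eq0 -lt0n.
have saw0 : \sum_(a < n | coprime a n) saw a = 0.
  rewrite -(big_mkord (fun a => coprime a n) saw) big_ltn_cond // ifF; last first.
    by apply/negbTE; rewrite /coprime gcd0n neq_ltn n1 orbT.
  apply: sum_odd_reflection => [|a /andP[_ an]]; first by rewrite pnatr_eq0.
  by rewrite coprime_subn ?saw_sub // ltnW.
have phi : (totient n)%:R = \sum_(a < n | coprime a n) (1 : R).
  rewrite totient_count_coprime natr_sum big_mkord [RHS]big_mkcond.
  by apply: eq_bigr => a _; rewrite coprime_sym; case: coprime.
rewrite S2_hyperbola natr_sum phi -(sum_hyperbola1 (fun=> 1 : R)).
have e1 := sum_hyperbola1 saw; have e2 := sum_hyperbola2 saw; rewrite saw0 in e1 e2.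
transitivity (n%:R ^+ 2 * \sum_(a < n) \sum_(b < n | (a * b == m %[mod n])%N) saw a * saw b
  + n%:R ^+ 2 / 2 * (\sum_(a < n) \sum_(b < n | (a * b == m %[mod n])%N) saw a)
  + n%:R ^+ 2 / 2 * (\sum_(a < n) \sum_(b < n | (a * b == m %[mod n])%N) saw b)); last first.
  by rewrite e1 e2 !mulr0 !addr0.
rewrite !mulr_sumr -sumrB -!big_split /=; apply: eq_bigr => a _.
rewrite natr_sum !mulr_sumr -sumrB -!big_split /=; apply: eq_bigr => b _.
by rewrite natrM /saw; field.
Qed.
End Hyperbola.

(** * Roots of unity and a lower bound for the sine *)

Section Sine.
Variable R : realType.
Implicit Types x y t : R.

Lemma sin_mvt y : 0 <= y -> exists2 c, 0 <= c <= y & sin y = cos c * y.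
Proof.
move=> y0; have [|c] := @MVT_segment R sin cos 0 y y0 (fun x _ => is_derive_sin x).
  by apply: continuous_subspaceT => x; exact: continuous_sin.
by rewrite in_itv /= sin0 !subr0 => cy E; exists c.
Qed.

Local Notation q := (pi / 4 : R).
Let q0 : 0 < q. Proof. by rewrite divr_gt0 ?pi_gt0. Qed.
Let qq : q *+ 2 = pi / 2. Proof. by rewrite -mulr_natr; field. Qed.

Lemma cos_piquarter : cos q ^+ 2 = 1 / 2 :> R.
Proof. have := cos_mulr2n q; rewrite qq cos_pihalf -mulr_natr; lra. Qed.

(** From sin (pi/4) <= pi/4. *)
Lemma pi_sqr_ge8 : 8 <= pi ^+ 2 :> R.
Proof.
have [c _ E] := sin_mvt (ltW q0).
have : sin q ^+ 2 <= q ^+ 2.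
  by rewrite E exprMn ler_piMl ?sqr_ge0 // cos2sin2 gerBl sqr_ge0.
rewrite sin2cos2 cos_piquarter; lra.
Qed.

(** By the mean value theorem sin t >= cos (pi/4) t, and cos t >= cos (pi/4). *)
Lemma sin_double_ge t : 0 <= t <= q -> t <= sin (t *+ 2).
Proof.
case/andP => t0 tq; have [c /andP[c0 ct] E] := sin_mvt t0.
have pi0 := pi_gt0 R.
have cosge x : 0 <= x <= q -> cos q <= cos x.
  case/andP=> x0 xq; rewrite leNgt ltr_cos ?in_itv /= -?leNgt //; lra.
have cq0 : 0 <= cos q by apply: cos_ge0_pihalf; lra.
have h1 : cos q <= cos c by apply: cosge; rewrite c0 (le_trans ct).
have h2 : cos q <= cos t by apply: cosge; rewrite t0.
rewrite sin_mulr2n E -mulr_natr.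
have : cos q ^+ 2 * t <= cos t * cos c * t.
  by rewrite ler_wpM2r // expr2 ler_pM.
rewrite cos_piquarter; lra.
Qed.

(** Apply [sin_double_ge] to both factors of sin (pi x) = 2 sin (pi x/2) cos
    (pi x/2); the resulting constant pi^2/8 is at least 1. *)
Lemma sin_pi_ge x : 0 <= x <= 1 -> x * (1 - x) <= sin (pi * x).
Proof.
case/andP => x0 x1; have pi0 := pi_gt0 R.
have -> : pi * x = (pi * x / 2) *+ 2 by rewrite -mulr_natr; field.
have s1 : pi * x / 4 <= sin (pi * x / 2).
  have -> : pi * x / 2 = (pi * x / 4) *+ 2 by rewrite -mulr_natr; field.
  apply: sin_double_ge; rewrite divr_ge0 ?mulr_ge0 ?(ltW pi0) //=.
  by rewrite ler_pM2r // ler_piMr // ltW.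
have s2 : pi * (1 - x) / 4 <= cos (pi * x / 2).
  have -> : cos (pi * x / 2) = sin ((pi * (1 - x) / 4) *+ 2).
    by rewrite -cosBpihalf -cosN; congr cos; rewrite -mulr_natr; field.
  apply: sin_double_ge; rewrite divr_ge0 ?mulr_ge0 ?subr_ge0 ?(ltW pi0) //=.
  by rewrite ler_pM2r // ler_piMr ?(ltW pi0) // lerBlDr lerDl.
rewrite sin_mulr2n -mulr_natr.
have p1 : 0 <= pi * x / 4 by rewrite divr_ge0 ?mulr_ge0 ?(ltW pi0).
have p2 : 0 <= pi * (1 - x) / 4 by rewrite divr_ge0 ?mulr_ge0 ?subr_ge0 ?(ltW pi0).
have := ler_pM p2 p1 s2 s1.
have p3 : 0 <= x * (1 - x) by rewrite mulr_ge0 ?subr_ge0.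
have : 8 * (x * (1 - x)) <= pi ^+ 2 * (x * (1 - x)) by rewrite ler_wpM2r // pi_sqr_ge8.
have -> : pi * (1 - x) / 4 * (pi * x / 4) = pi ^+ 2 * (x * (1 - x)) / 16 by field.
lra.
Qed.
End Sine.

Section RootOfUnity.
Local Open Scope complex_scope.
Variable R : realType.
Local Notation C := (R[i]).

Definition expi (t : R) : C := cos t +i* sin t.

Lemma expiD s t : expi (s + t) = expi s * expi t.
Proof.
apply/eqP; rewrite eq_complex /= cosD sinD eqxx /=.
by rewrite addrC eqxx.
Qed.

Lemma expi_natM t k : expi t ^+ k = expi (k%:R * t).
Proof.
elim: k => [|k IH]; first by rewrite mul0r /expi cos0 sin0.
by rewrite exprS IH -expiD -natr1 mulrDl mul1r addrC.
Qed.

Lemma expi_2pi : expi (pi *+ 2) = 1.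
Proof. by rewrite /expi cos2pi sin2pi. Qed.

Lemma norm_expi_sub1 t : `|expi (t *+ 2) - 1| = (2 * `|sin t|)%:C.
Proof.
rewrite normc_def /=; congr (_%:C).
have -> : (cos (t *+ 2) - 1) ^+ 2 + (sin (t *+ 2) - 0) ^+ 2 = (2 * sin t) ^+ 2.
  rewrite cos_mulr2n sin_mulr2n subr0 !mulr2n.
  have -> : (cos t * sin t + cos t * sin t) ^+ 2 = 4 * cos t ^+ 2 * sin t ^+ 2 by ring.
  by rewrite cos2sin2; ring.
by rewrite sqrtr_sqr normrM ger0_norm.
Qed.

Variables (n : nat) (n1 : (1 < n)%N).
Definition zeta : C := expi ((pi / n%:R) *+ 2).
Let n0 : 0 < n%:R :> R. Proof. by rewrite ltr0n ltnW. Qed.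

Lemma norm_zeta_sub1 h : (h <= n)%N ->
  (2 * (h%:R / n%:R) * (1 - h%:R / n%:R))%:C <= `|zeta ^+ h - 1|.
Proof.
move=> hn; rewrite /zeta expi_natM mulrnAr norm_expi_sub1 lecR.
rewrite -mulrA ler_pM2l // (_ : h%:R * _ = pi * (h%:R / n%:R)); last by rewrite mulrCA.
apply: le_trans (ler_norm _); apply: sin_pi_ge.
by rewrite divr_ge0 //= ler_pdivrMr // mul1r ler_nat.
Qed.

Lemma zeta_n : zeta ^+ n = 1.
Proof.
by rewrite /zeta expi_natM mulrnAr mulrC divfK ?gt_eqF // expi_2pi.
Qed.

(** The order is exactly n by the lower bound for the distance to 1. *)
Lemma prim_zeta : n.-primitive_root zeta.
Proof.
apply/andP; split; first exact: ltnW.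
apply/forallP => -[h hn] /=; apply/eqP; rewrite unity_rootE.
have [->|hn'] := eqVneq h.+1 n; first by rewrite zeta_n eqxx.
have lt : (h.+1 < n)%N by rewrite ltn_neqAle hn'.
apply/negbTE/eqP => z1; have := norm_zeta_sub1 (ltnW lt).
rewrite z1 subrr normr0 lecR leNgt => /negP; apply.
apply: mulr_gt0; first by rewrite mulr_gt0 ?divr_gt0 ?ltr0n // ltnW.
by rewrite subr_gt0 ltr_pdivrMr // mul1r ltr_nat.
Qed.
End RootOfUnity.

(** * Fourier coefficients of the sawtooth function *)

Section Geometric.
Variables (F : fieldType) (n : nat) (w : F).
Hypothesis wn : w ^+ n = 1.

Lemma sum_geometric : \sum_(h < n) w ^+ h = if w == 1 then n%:R else 0.
Proof.
case: eqP => [->|/eqP w1].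
  by under eq_bigr do rewrite expr1n; rewrite sumr_const card_ord.
have : (w - 1) * \sum_(h < n) w ^+ h = 0 by rewrite -subrX1 wn subrr.
by move/eqP; rewrite mulf_eq0 subr_eq0 (negbTE w1) => /eqP.
Qed.

(** Summation by parts. *)
Lemma sum_natr_geometric : w != 1 -> (w - 1) * \sum_(a < n) a%:R * w ^+ a = n%:R.
Proof.
move=> w1; have G := sum_geometric; rewrite (negbTE w1) in G.
suff H N : (w - 1) * \sum_(a < N) a%:R * w ^+ a = N%:R * w ^+ N - w * \sum_(a < N) w ^+ a.
  by rewrite H wn G mulr1 mulr0 subr0.
elim: N => [|N IH]; first by rewrite !big_ord0 mulr0 mul0r mulr0 subrr.
by rewrite !big_ord_recr /= !mulrDr IH -natr1 exprS; ring.
Qed.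
End Geometric.

Section Fourier.
Local Open Scope complex_scope.
Variables (R : realType) (n : nat) (n1 : (1 < n)%N).
Local Notation C := (R[i]).
Local Notation z := (zeta R n).
Local Notation s a := ((saw n R a)%:C).
Let n0 : (0 < n)%N := ltnW n1.
Let N0 : n%:R != 0 :> C. Proof. by rewrite pnatr_eq0 -lt0n. Qed.

(** The sum starts at 1: the expansion is that of the odd function that
    vanishes at 0, not of saw, whose value there is -1/2. The exponent h (n -
    a) stands for - h a. *)
Definition sawhat h : C := n%:R^-1 * \sum_(1 <= a < n) s a * z ^+ (h * (n - a)).

Lemma saw_fourier b : (0 < b < n)%N -> s b = \sum_(h < n) sawhat h * z ^+ (h * b).
Proof.
move=> /andP[b0 bn]; have pz := prim_zeta R n1.
transitivity (n%:R^-1 * \sum_(1 <= a < n) s a * \sum_(h < n) (z ^+ (n - a + b)) ^+ h); last first.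
  rewrite /sawhat; under [RHS]eq_bigr do rewrite -mulrA mulr_suml.
  rewrite -mulr_sumr; congr (_ * _); rewrite exchange_big /=; apply: eq_bigr => a _.
  rewrite mulr_sumr; apply: eq_bigr => h _.
  by rewrite -mulrA -exprD -mulnDr -exprM mulnC.
rewrite (bigD1_seq b) ?iota_uniq ?mem_index_iota ?b0 //=.
rewrite subnK 1?ltnW // (prim_expr_order pz).
rewrite (sum_geometric (expr1n _ n)) eqxx.
rewrite big_nat_cond big1 ?addr0 => [|a /andP[/andP[a0 an] ab]].
  by rewrite mulrC mulfK.
rewrite (sum_geometric (n := n)); last by rewrite -exprM mulnC exprM (prim_expr_order pz) expr1n.
rewrite -(prim_order_dvd pz) ifF ?mulr0 //; apply/negbTE/negP => /dvdnP[k kE].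
move: ab; apply/negP; rewrite negbK.
have := kE; case: k {kE} => [|[|k]]; rewrite ?mul0n ?mul1n ?mulSn; lia.
Qed.

Lemma sawhat0 : sawhat 0 = 0.
Proof.
rewrite /sawhat; under eq_bigr do rewrite mul0n expr0 mulr1.
rewrite (@sum_odd_reflection n _ xpredT) ?mulr0 // ?pnatr_eq0 // => a /andP[_ an].
by rewrite saw_sub ?rmorphN // ltnW.
Qed.

(** With w = z^(-h), the closed forms of the geometric sums give n sawhat(h)
    = (w + 1) / (2 (w - 1)). The numerator is at most 2 in absolute value,
    and [norm_zeta_sub1] bounds |w - 1| from below by 2 h (n - h) / n^2. *)
Lemma norm_sawhat h : (0 < h < n)%N ->
  `|sawhat h| <= (1 / 2 * (h%:R^-1 + (n - h)%:R^-1))%:C.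
Proof.
move=> /andP[h0 hn]; have pz := prim_zeta R n1; have zn := prim_expr_order pz.
pose w := z ^+ (n - h).
have wn : w ^+ n = 1 by rewrite -exprM mulnC exprM zn expr1n.
have w1 : w != 1.
  rewrite -(prim_order_dvd pz) gtnNdvd ?subn_gt0 //.
  by rewrite ltn_subrL h0.
have E : (w - 1) * (n%:R * sawhat h) = (w + 1) / 2.
  rewrite /sawhat mulVKf //.
  transitivity ((w - 1) * (\sum_(a < n) (a%:R / n%:R - 1 / 2) * w ^+ a + 1 / 2)).
    congr (_ * _); rewrite -(big_mkord xpredT (fun a => (a%:R / n%:R - 1 / 2) * w ^+ a)).
    rewrite [X in _ = X + _]big_ltn // mul0r sub0r expr0 mulr1 addrAC addNr add0r.
    apply: eq_big_nat => a /andP[a0 an].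
    congr (_ * _).
      rewrite /saw rmorphB rmorphM fmorphV rmorph_nat rmorph_nat.
      by rewrite fmorph_div rmorph1 rmorph_nat.
    rewrite -exprM -(expr_mod _ zn) -[RHS](expr_mod _ zn); congr (_ ^+ _).
    apply/eqP; rewrite -(eqn_modDr (h * a)) -mulnDr subnK ?(ltnW an) //.
    by rewrite -mulnDl subnK ?(ltnW hn) // modnMr modnMl.
  have G := sum_geometric wn; rewrite (negbTE w1) in G.
  have A := sum_natr_geometric wn w1.
  have -> : \sum_(a < n) (a%:R / n%:R - 1 / 2) * w ^+ a =
     n%:R^-1 * (\sum_(a < n) a%:R * w ^+ a) - 1 / 2 * \sum_(a < n) w ^+ a.
    by rewrite !mulr_sumr -sumrB; apply: eq_bigr => a _; ring.
  by rewrite G mulrDr mulrBr mulrCA A mulVf // mulr0; field.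
have nw : `|w| = 1.
  by apply/eqP; rewrite -(@pexpr_eq1 _ _ n) // -normrX wn normr1.
have B : `|w - 1| * (n%:R * `|sawhat h|) <= 1.
  rewrite -[n%:R]normr_nat -!normrM E normrM normfV normr_nat.
  rewrite ler_pdivrMr ?ltr0n // mul1r; apply: le_trans (ler_normD _ _) _.
  by rewrite nw normr1.
have L := norm_zeta_sub1 R n1 (leq_subr h n); rewrite -/w in L.
pose x : R := (n - h)%:R / n%:R.
have nR : 0 < n%:R :> R by rewrite ltr0n.
have hR : 0 < h%:R :> R by rewrite ltr0n.
have nhR : 0 < (n - h)%:R :> R by rewrite ltr0n subn_gt0.
have nhE : (n - h)%:R = n%:R - h%:R :> R by rewrite natrB // ltnW.
have xE : 1 - x = h%:R / n%:R by rewrite /x nhE; field; rewrite gt_eqF.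
have d0 : 0 < 2 * x * (1 - x) * n%:R.
  have x0 : 0 < x by apply: divr_gt0.
  have hn0 : 0 < h%:R / n%:R :> R by apply: divr_gt0.
  by apply: mulr_gt0 => //; apply: mulr_gt0; [apply: mulr_gt0|rewrite xE].
have : (2 * x * (1 - x) * n%:R)%:C * `|sawhat h| <= 1.
  apply: le_trans B; set A := 2 * x * (1 - x).
  have -> : (A * n%:R)%:C = A%:C * n%:R by rewrite rmorphM rmorph_nat.
  by rewrite -mulrA ler_wpM2r ?mulr_ge0 ?ler0n.
rewrite -ler_pdivlMl; last by rewrite ltcR.
move/le_trans; apply; rewrite mulr1 -fmorphV lecR.
rewrite xE /x nhE in nhR *; rewrite le_eqVlt; apply/orP; left; apply/eqP.
by field; rewrite !gt_eqF.
Qed.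
End Fourier.

Section Harmonic.
Variable R : realType.

(** The step is ln ((N+1) / (N+2)) <= - 1 / (N+2), which is 1 + t <= exp t.
    The term j = 0 is harmless, as the inverse of 0 is 0. *)
Lemma harmonic_le N : (0 < N)%N -> \sum_(0 <= j < N.+1) (j%:R : R)^-1 <= 1 + ln N%:R.
Proof.
elim: N => // -[_ _|N IH _].
  by rewrite ln1 addr0 !big_nat_recr //= big_nil invr0 invr1 add0r add0r.
rewrite big_nat_recr //=; apply: le_trans (lerD (IH isT) (lexx _)) _.
rewrite -addrA lerD2l.
have a0 : 0 < N.+1%:R :> R by rewrite ltr0n.
have b0 : 0 < N.+2%:R :> R by rewrite ltr0n.
have : N.+1%:R / N.+2%:R <= expR (- N.+2%:R^-1) :> R.
  apply: le_trans (expR_ge1Dx _).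
  have -> : N.+1%:R = N.+2%:R - 1 :> R by rewrite -[N.+2%:R]natr1 addrK.
  by rewrite mulrBl divff ?gt_eqF // mul1r.
move=> H; have : ln (N.+1%:R / N.+2%:R) <= - N.+2%:R^-1 :> R.
  by rewrite -[leRHS]expRK ler_ln ?posrE ?divr_gt0 ?expR_gt0.
by rewrite ln_div ?posrE // lerBlDl lerBrDr.
Qed.

Lemma sum_inv_le N : (0 < N)%N -> \sum_(0 <= j < N) (j%:R : R)^-1 <= 1 + ln N%:R.
Proof.
move=> N0; apply: le_trans (harmonic_le N0).
by rewrite big_nat_recr //= lerDl invr_ge0.
Qed.

Lemma sum_multiples_of (V : nmodType) (F : nat -> V) d N : (0 < d)%N ->
  \sum_(0 <= h < N * d | (d %| h)%N) F h = \sum_(0 <= j < N) F (j * d)%N.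
Proof.
move=> d0; elim: N => [|N IH]; first by rewrite mul0n !big_geq.
rewrite (@big_cat_nat _ _ _ (N * d)) //=; last by rewrite leq_mul2r leqnSn orbT.
rewrite IH big_nat_recr //=; congr (_ + _).
rewrite big_ltn_cond; last by rewrite ltn_mul2r d0 ltnSn.
rewrite dvdn_mull // big_nat_cond big_pred0 ?addr0 // => h.
apply/negP => /andP[/andP[h1 h2] /dvdnP[k kE]].
move: h1 h2; rewrite kE ltn_mul2r ltn_pmul2r // ltnS => /andP[_ h1].
by rewrite leqNgt h1.
Qed.

(** The reflection h |-> n - h preserves the multiples of d, so the two
    halves are equal; the sum of 1/h over h = d j is 1/d times a harmonic
    sum. *)
Lemma weight_sum n d : (0 < n)%N -> (d %| n)%N ->
  \sum_(1 <= h < n | (d %| h)%N) (1 / 2 * (h%:R^-1 + (n - h)%:R^-1) : R) <=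
    (1 + ln n%:R) / d%:R.
Proof.
move=> n0 dn; have d0 : (0 < d)%N := dvdn_gt0 n0 dn.
have dR : 0 < d%:R :> R by rewrite ltr0n.
rewrite -mulr_sumr big_split /=.
have -> : \sum_(1 <= h < n | (d %| h)%N) ((n - h)%:R : R)^-1 =
    \sum_(1 <= h < n | (d %| h)%N) (h%:R : R)^-1.
  rewrite [RHS]big_nat_rev /= add1n big_nat_cond [RHS]big_nat_cond.
  apply: eq_big => h; last by rewrite subSS.
  by case: (boolP (1 <= h < n)%N) => //= /andP[_ hn]; rewrite subSS dvdn_subr // ltnW.
have half_twice (x : R) : 1 / 2 * (x + x) = x by field.
rewrite half_twice.
have [N NE] : exists N, n = (N * d)%N by exists (n %/ d)%N; rewrite divnK.
have N0 : (0 < N)%N by move: n0; rewrite NE muln_gt0 => /andP[].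
have -> : \sum_(1 <= h < n | (d %| h)%N) (h%:R : R)^-1 =
    \sum_(0 <= h < n | (d %| h)%N) (h%:R : R)^-1.
  by rewrite [RHS]big_ltn_cond // dvdn0 invr0 add0r.
rewrite NE sum_multiples_of //.
under eq_bigr do rewrite natrM invfM.
rewrite -mulr_suml ler_pM2r ?invr_gt0 //; apply: le_trans (sum_inv_le N0) _.
rewrite lerD2l ler_ln ?posrE ?ltr0n -?NE // ler_nat.
by rewrite NE leq_pmulr.
Qed.
End Harmonic.

(** * The error term as a weighted sum of Kloosterman sums *)

Section Final.
Local Open Scope complex_scope.
Variables (R : realType) (n m : nat) (n1 : (1 < n)%N) (cmn : coprime m n).
Local Notation C := (R[i]).
Local Notation z := (zeta R n).
Local Notation saw := (saw n R).
Let n0 : (0 < n)%N := ltnW n1.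

Definition saw_sum : R :=
  \sum_(a < n) \sum_(b < n | (a * b == m %[mod n])%N) saw a * saw b.

(** The Fourier expansion [saw_fourier] is not valid at 0. *)
Lemma hyperbola_pos (a b : 'I_n) : (a * b == m %[mod n])%N ->
  (0 < a < n)%N /\ (0 < b < n)%N.
Proof.
move=> /eqP E; rewrite !ltn_ord !andbT !lt0n.
have nc0 : ~~ coprime 0 n by rewrite /coprime gcd0n neq_ltn n1 orbT.
split; apply: contra nc0 => /eqP x0; rewrite -x0; apply: (coprime_of_mul cmn).
  exact: E.
by rewrite mulnC; exact: E.
Qed.

Lemma saw_sum_Kl :
  saw_sum%:C = \sum_(h < n) \sum_(k < n) sawhat R n h * sawhat R n k * Kl z n m h k.
Proof.
rewrite /saw_sum rmorph_sum /=.
transitivity (\sum_(a < n) \sum_(b < n | (a * b == m %[mod n])%N) \sum_(h < n) \sum_(k < n)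
   sawhat R n h * sawhat R n k * z ^+ (h * a + k * b)).
  apply: eq_bigr => a _; rewrite rmorph_sum /=; apply: eq_bigr => b /hyperbola_pos[a0 b0].
  rewrite rmorphM /= (saw_fourier R n1 a0) (saw_fourier R n1 b0) mulr_suml.
  apply: eq_bigr => h _; rewrite mulr_sumr; apply: eq_bigr => k _.
  by rewrite exprD mulrACA.
pose F h k (a b : nat) : C := sawhat R n h * sawhat R n k * z ^+ (h * a + k * b).
have swap (X : 'I_n -> nat -> nat -> C) :
    \sum_(a < n) \sum_(b < n | (a * b == m %[mod n])%N) \sum_(h < n) X h a b =
    \sum_(h < n) \sum_(a < n) \sum_(b < n | (a * b == m %[mod n])%N) X h a b.
  by rewrite [RHS]exchange_big /=; apply: eq_bigr => a _; rewrite exchange_big.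
rewrite (swap (fun h a b => \sum_(k < n) F h k a b)); apply: eq_bigr => h _.
rewrite (swap (fun k a b => F h k a b)); apply: eq_bigr => k _.
by rewrite /Kl mulr_sumr; apply: eq_bigr => a _; rewrite mulr_sumr.
Qed.

Local Notation tau := (size (divisors n)).
Let rt (x : R) := Num.sqrt x.
(** The square root of gcd(h, k, n) is one of the terms; in each term the
    conditions on h and k are independent, so that the sums over h and k
    separate. *)
Let gsum h k : R := \sum_(d <- divisors n | (d %| h)%N && (d %| k)%N) rt d%:R.
Let B : R := tau%:R * rt n%:R.

Lemma norm_Kl_le h k : `|Kl z n m h k| <= (B * gsum h k)%:C.
Proof.
have K := @Kl_bound R n z m h k n0 (prim_zeta R n1) cmn.
have nr : `|Kl z n m h k| = (complex.Re `|Kl z n m h k|)%:C.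
  by rewrite RRe_real // normr_real.
rewrite nr in K *; move: K; set x := complex.Re _.
rewrite -rmorphXn -(rmorph_nat (real_complex R)) /= !lecR => K.
set g := gcdn (gcdn h k) n in K.
have x_le : x <= B * rt g%:R.
  apply: le_trans (ler_norm x) _; rewrite -sqrtr_sqr /B /rt.
  rewrite -[X in X * _ * _]ger0_norm // -[X in X * _ * _]sqrtr_sqr.
  rewrite -!sqrtrM ?mulr_ge0 ?sqr_ge0 // ler_wsqrtr //.
  by apply: le_trans K _; rewrite -natrX -!natrM ler_nat mulnAC.
apply: le_trans x_le _; rewrite ler_wpM2l ?mulr_ge0 ?sqrtr_ge0 //.
have gn : (g %| n)%N by rewrite dvdn_gcdr.
have gh : (g %| h)%N by rewrite (dvdn_trans (dvdn_gcdl _ _)) // dvdn_gcdl.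
have gk : (g %| k)%N by rewrite (dvdn_trans (dvdn_gcdl _ _)) // dvdn_gcdr.
rewrite /gsum big_mkcond (bigD1_seq g) ?divisors_uniq -?dvdn_divisors //= gh gk /=.
by rewrite lerDl sumr_ge0 // => d _; case: ifP; rewrite ?sqrtr_ge0.
Qed.

Let G h : R := 1 / 2 * (h%:R^-1 + (n - h)%:R^-1).
Let G0 h : 0 <= G h.
Proof. by rewrite mulr_ge0 ?addr_ge0 ?invr_ge0 ?divr_ge0. Qed.
Let L : R := 1 + ln n%:R.
Let L0 : 0 <= L.
Proof. by rewrite addr_ge0 // ln_ge0 // ler1n. Qed.
Let B0 : 0 <= B.
Proof. by rewrite mulr_ge0 ?sqrtr_ge0. Qed.

Lemma norm_saw_sum_le : `|saw_sum| <=
  \sum_(1 <= h < n) \sum_(1 <= k < n) G h * G k * (B * gsum h k).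
Proof.
have tail (F : nat -> C) : F 0%N = 0 -> \sum_(h < n) F h = \sum_(1 <= h < n) F h.
  by move=> F0; rewrite -(big_mkord xpredT) big_ltn // F0 add0r.
have : `|saw_sum|%:C = `|saw_sum%:C| by rewrite normc_def /= expr0n addr0 sqrtr_sqr.
rewrite saw_sum_Kl (tail (fun h => \sum_(k < n) sawhat R n h * sawhat R n k * Kl z n m h k)); last first.
  by rewrite big1 // => k _; rewrite (sawhat0 R n1) !mul0r.
move=> E; rewrite -lecR E rmorph_sum /=; apply: le_trans (ler_norm_sum _ _ _) _.
apply: ler_sum_nat => h hn.
rewrite (tail (fun k => sawhat R n h * sawhat R n k * Kl z n m h k)); last first.
  by rewrite (sawhat0 R n1) mulr0 mul0r.
rewrite rmorph_sum /=; apply: le_trans (ler_norm_sum _ _ _) _.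
apply: ler_sum_nat => k kn.
have castM (x y w : R) : (x * y * w)%:C = x%:C * y%:C * w%:C by rewrite !rmorphM.
have normM3 (x y w : C) : `|x * y * w| = `|x| * `|y| * `|w| by rewrite !normrM.
rewrite normM3 castM.
apply: ler_pM; rewrite ?mulr_ge0 ?norm_Kl_le //.
by apply: ler_pM => //; apply: norm_sawhat.
Qed.

Lemma saw_sum_bound : `|saw_sum| <= B * (tau%:R * L ^+ 2).
Proof.
apply: le_trans norm_saw_sum_le _.
have -> : \sum_(1 <= h < n) \sum_(1 <= k < n) G h * G k * (B * gsum h k) =
  B * \sum_(d <- divisors n) rt d%:R * (\sum_(1 <= h < n | (d %| h)%N) G h) ^+ 2.
  transitivity (B * \sum_(1 <= h < n) \sum_(1 <= k < n) \sum_(d <- divisors n)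
     (if (d %| h)%N && (d %| k)%N then rt d%:R * (G h * G k) else 0)).
    rewrite mulr_sumr; apply: eq_bigr => h _; rewrite mulr_sumr; apply: eq_bigr => k _.
    rewrite -big_mkcond /= mulrCA; congr (_ * _); rewrite mulr_sumr.
    by apply: eq_bigr => d _; rewrite mulrC.
  congr (_ * _); under eq_bigr do rewrite exchange_big /=.
  rewrite exchange_big /=; apply: eq_bigr => d _.
  rewrite expr2 [X in _ * (X * _)]big_mkcond mulr_suml mulr_sumr /=; apply: eq_bigr => h _.
  rewrite [X in _ * (_ * X)]big_mkcond /= !mulr_sumr; apply: eq_bigr => k _.
  by do 2!case: (d %| _)%N; rewrite ?mulr0 ?mul0r ?mulr0.
rewrite ler_wpM2l //.
have -> : tau%:R * L ^+ 2 = \sum_(d <- divisors n) L ^+ 2.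
  by rewrite big_const_seq count_predT iter_addr_0; exact: mulr_natl.
rewrite big_seq [leRHS]big_seq; apply: ler_sum => d; rewrite -dvdn_divisors // => dn.
have d0 : (0 < d)%N := dvdn_gt0 n0 dn.
have dR : 1 <= d%:R :> R by rewrite ler1n.
have d2 : d%:R <= d%:R ^+ 2 :> R by rewrite expr2 ler_peMr.
apply: (@le_trans _ _ (rt d%:R * (L / d%:R) ^+ 2)).
  rewrite ler_wpM2l ?sqrtr_ge0 // ler_pXn2r ?nnegrE ?sumr_ge0 ?divr_ge0 //.
  exact: weight_sum.
rewrite exprMn mulrCA -[leRHS]mulr1 ler_wpM2l ?sqr_ge0 // exprVn.
rewrite ler_pdivrMr ?exprn_gt0 ?ltr0n // mul1r; apply: le_trans d2.
by rewrite -[leRHS]ger0_norm // -sqrtr_sqr ler_wsqrtr // expr2 ler_peMr.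
Qed.
End Final.

Theorem theorem3 (R : realType) (n m : nat) (hn : (2 <= n)%N) (hm : (1 <= m)%N)
    (hmn : coprime m n) :
  `| (S2 n m)%:R - 1 / 4 * n%:R ^+ 2 * (totient n)%:R |
    <= n%:R ^+ 2 * sigma (1 / 2 : R) n * (tau R n * ln (expR 1 * n%:R)) ^+ 2
       + 1 / 4 * n%:R * (totient n)%:R.
Proof.
have n0 : (0 < n)%N := ltnW hn.
have nR : 0 < n%:R :> R by rewrite ltr0n.
apply: (@le_trans _ _ (n%:R ^+ 2 * sigma (1 / 2 : R) n *
    (tau R n * ln (expR 1 * n%:R)) ^+ 2)); last first.
  by rewrite lerDl !mulr_ge0.
rewrite (S2_saw hn hmn) normrM ger0_norm ?sqr_ge0 // -[leRHS]mulrA ler_wpM2l ?sqr_ge0 //.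
apply: le_trans (saw_sum_bound R hn hmn) _.
have -> : ln (expR 1 * n%:R) = 1 + ln n%:R :> R by rewrite lnM ?posrE ?expR_gt0 // expRK.
rewrite tauE; set t := _%:R; set L := 1 + _.
have -> : t * Num.sqrt n%:R * (t * L ^+ 2) = Num.sqrt n%:R * (t * L) ^+ 2 by ring.
rewrite ler_wpM2r ?sqr_ge0 // /sigma (bigD1_seq n) ?divisors_uniq -?dvdn_divisors //=.
by rewrite div1r powR12_sqrt ?(ltW nR) // lerDl sumr_ge0 // => d _; exact: powR_ge0.
Qed.
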